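(* Let $k,m\geq 1$ be integers, and let $a\colon\mathbb{T}^k\to\mathbb{R}^m$ and $b\colon\mathbb{T}^m\to\mathbb{R}^m$ be mappings of class $A$. Assume that $b$ coincides with a non-degenerate affine mapping in some domain $J\subseteq[-\pi,\pi]^m$; that is, there are a real $m\times m$ matrix $P$ with $\det P\neq 0$ and a vector $y_0\in\mathbb{R}^m$ such that $b(y)=Py+y_0$ for all $y\in J$. Assume in addition that the image $a(\mathbb{T}^k)$ has positive Lebesgue measure in $\mathbb{R}^m$. Let $\varphi\colon\mathbb{T}^{k+m}\to\mathbb{R}$ be defined as the inner product $\varphi(x,y)=(a(x),b(y))$ for $x\in\mathbb{T}^k$, $y\in\mathbb{T}^m$. Then $$\|e^{i\lambda\varphi}\|_{A(\mathbb{T}^{k+m})}\gtrsim|\lambda|^m,\qquad\lambda\in\mathbb{R},\ |\lambda|\to\infty;$$ that is, there exist constants $c>0$ and $\lambda_0>0$, independent of $\lambda$, such that $\|e^{i\lambda\varphi}\|_{A(\mathbb{T}^{k+m})}\geq c|\lambda|^m$ for all $\lambda\in\mathbb{R}$ with $|\lambda|\geq\lambda_0$.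
   Context: $\mathbb{T}^d=\mathbb{R}^d/(2\pi\mathbb{Z})^d$; functions on $\mathbb{T}^d$ are identified with functions on $\mathbb{R}^d$ that are $2\pi$-periodic in each variable. $(\cdot,\cdot)$ is the Euclidean inner product. A domain is a nonempty connected open set. For a function $f$ on $\mathbb{T}^d$, $\widehat f(n)=\frac{1}{(2\pi)^d}\int_{\mathbb{T}^d}f(t)e^{-i(n,t)}\,dt$, $n\in\mathbb{Z}^d$. $A(\mathbb{T}^d)$ is the space of all continuous (complex-valued) functions $f$ on $\mathbb{T}^d$ with $\|f\|_{A(\mathbb{T}^d)}=\sum_{n\in\mathbb{Z}^d}|\widehat f(n)|<\infty$; it is a Banach algebra under pointwise multiplication. A mapping $s=(s_1,\dots,s_q)\colon\mathbb{T}^p\to\mathbb{R}^q$ is of class $A$ if all its coordinate functions $s_j\colon\mathbb{T}^p\to\mathbb{R}$ belong to $A(\mathbb{T}^p)$. *)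

(* Defs.v *)
From HB Require Import structures.
From mathcomp Require Import all_boot all_order all_algebra.
From mathcomp Require Import all_classical all_reals all_analysis.
From mathcomp Require Import complex.

Set Implicit Arguments.
Unset Strict Implicit.
Unset Printing Implicit Defensive.
Import Order.TTheory GRing.Theory Num.Theory.
Import numFieldNormedType.Exports.

Local Open Scope classical_set_scope.
Local Open Scope ring_scope.
Local Open Scope complex_scope.

(* R^d is 'cV[R]_d.  The library has Lebesgue measure on R only; the measure on
   'cV[R]_d is built below, on the sigma-algebra generated by the coordinates
   (the Borel sets), by iterating the product with the measure on R. *)

Definition measure_matrix_display : measure_display -> measure_display.
Proof. exact. Qed.

Section measurable_matrix.
Context {R : realType} (m n : nat).

Definition matrix_cylinders : set (set 'M[R]_(m, n)) :=
  [set A | exists i j, exists2 B, measurable B & A = [set M : 'M[R]_(m, n) | B (M i j)]].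

Let matrix_set0 : <<s matrix_cylinders >> set0.
Proof. exact: sigma_algebra0. Qed.

Let matrix_setC A :
  <<s matrix_cylinders >> A -> <<s matrix_cylinders >> (~` A).
Proof. exact: sigma_algebraC. Qed.

Let matrix_bigcup (F : (set 'M[R]_(m, n))^nat) :
  (forall i, <<s matrix_cylinders >> (F i)) ->
  <<s matrix_cylinders >> (\bigcup_i (F i)).
Proof. exact: sigma_algebra_bigcup. Qed.

HB.instance Definition _ :=
  @isMeasurable.Build (measure_matrix_display default_measure_display)
    'M[R]_(m, n) <<s matrix_cylinders >> matrix_set0 matrix_setC matrix_bigcup.

Lemma measurable_coord i j :
  measurable_fun setT (fun M : 'M[R]_(m, n) => M i j).
Proof.
move=> _ B mB; rewrite setTI; apply: sub_sigma_algebra.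
by exists i, j, B.
Qed.

Lemma measurable_fun_matrix d (T : measurableType d) (f : T -> 'M[R]_(m, n)) :
  (forall i j, measurable_fun setT (fun x => f x i j)) -> measurable_fun setT f.
Proof.
move=> mf; apply: (@measurability _ _ _ _ setT f matrix_cylinders) => //.
move=> _ [_ [i [j [B mB ->]]] <-].
by have := mf i j measurableT _ mB; rewrite !setTI.
Qed.

End measurable_matrix.

Section lebesgue_step.
Context {R : realType} (n : nat).

Definition cV_cons (p : R * 'cV[R]_n) : 'cV[R]_n.+1 := col_mx p.1%:M p.2.

Lemma cV_cons0 p : cV_cons p ord0 0 = p.1.
Proof.
have <- : p.1%:M (0 : 'I_1) (0 : 'I_1) = p.1 by rewrite mxE.
rewrite -(col_mxEu p.1%:M p.2 0 0).
by congr (col_mx _ _ _ _); exact/val_inj.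
Qed.

Lemma cV_consS p (i : 'I_n) : cV_cons p (lift ord0 i) 0 = p.2 i 0.
Proof.
rewrite -(col_mxEd p.1%:M p.2 i 0).
by congr (col_mx _ _ _ _); exact/val_inj.
Qed.

Lemma measurable_cV_cons : measurable_fun setT cV_cons.
Proof.
apply: measurable_fun_matrix => i j; rewrite ord1.
case: (unliftP ord0 i) => [i' ->|->].
- under eq_fun do rewrite cV_consS.
  exact: measurableT_comp (measurable_coord i' 0) measurable_snd.
- under eq_fun do rewrite cV_cons0.
  exact: measurable_fst.
Qed.


Definition cV_uncons (v : 'cV[R]_n.+1) : R * 'cV[R]_n :=
  (v ord0 0, \col_i v (lift ord0 i) 0).

Lemma cV_consK : cancel cV_cons cV_uncons.
Proof.
move=> p; rewrite /cV_uncons cV_cons0 [RHS]surjective_pairing; congr (_, _).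
by apply/matrixP => i j; rewrite ord1 mxE cV_consS.
Qed.

Lemma cV_unconsK : cancel cV_uncons cV_cons.
Proof.
move=> v; apply/matrixP => i j; rewrite ord1.
by case: (unliftP ord0 i) => [i' ->|->]; rewrite (cV_cons0, cV_consS)//= mxE.
Qed.

Lemma measurable_cV_uncons : measurable_fun setT cV_uncons.
Proof.
apply/measurable_fun_pairP; split; first exact: measurable_coord.
apply: measurable_fun_matrix => i j; rewrite ord1.
under eq_fun do rewrite /= mxE.
exact: measurable_coord.
Qed.

Variable mu : {sigma_finite_measure set 'cV[R]_n -> \bar R}.

Definition lebesgue_cons : set 'cV[R]_n.+1 -> \bar R :=
  pushforward (lebesgue_measure \x mu)%E (cV_cons : measurableTypeR R * _ -> _).

Let mcons : measurable_fun setT (cV_cons : measurableTypeR R * _ -> _).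
Proof. exact: measurable_cV_cons. Qed.

Let lebesgue_cons0 : lebesgue_cons set0 = 0%E.
Proof. exact: measure0. Qed.

Let lebesgue_cons_ge0 A : (0 <= lebesgue_cons A)%E.
Proof. exact: measure_ge0. Qed.

Let lebesgue_cons_sigma_additive : semi_sigma_additive lebesgue_cons.
Proof. exact: measure_semi_sigma_additive. Qed.

HB.instance Definition _ := isMeasure.Build _ _ _ lebesgue_cons
  lebesgue_cons0 lebesgue_cons_ge0 lebesgue_cons_sigma_additive.

Let lebesgue_cons_sigma_finite : sigma_finite setT lebesgue_cons.
Proof.
pose leb : {sigma_finite_measure set (measurableTypeR R) -> \bar R} :=
  @lebesgue_measure R.
have /sigma_finiteP[F [FT ndF mF]] := sigma_finiteT leb.
have /sigma_finiteP[G [GT ndG mG]] := sigma_finiteT mu.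
exists (fun i => cV_uncons @^-1` (F i `*` G i)).
  rewrite -preimage_bigcup (_ : \bigcup_i _ = setT) ?preimage_setT//.
  rewrite -subTset => -[x y] _.
  have [i _ Fx] : (\bigcup_i F i) x by rewrite -FT.
  have [j _ Gy] : (\bigcup_i G i) y by rewrite -GT.
  exists (maxn i j) => //; split.
    by move: x Fx; exact/subsetPset/ndF/leq_maxl.
  by move: y Gy; exact/subsetPset/ndG/leq_maxr.
move=> i; have [mFi Fioo] := mF i; have [mGi Gioo] := mG i; split.
  rewrite -[X in measurable X]setTI; apply: measurable_cV_uncons => //.
  exact: measurableX.
rewrite /lebesgue_cons /pushforward -comp_preimage (_ : _ \o _ = id); last first.
  by rewrite funeqE => p /=; exact: cV_consK.
by rewrite preimage_id product_measure1E// lte_mul_pinfty// ge0_fin_numE.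
Qed.

HB.instance Definition _ := Measure_isSigmaFinite.Build _ _ _ lebesgue_cons
  lebesgue_cons_sigma_finite.

End lebesgue_step.

Fixpoint lebesgue_cV (R : realType) (d : nat) :
    {sigma_finite_measure set 'cV[R]_d -> \bar R} :=
  if d is n.+1 then lebesgue_cons (lebesgue_cV R n) else \d_(0 : 'cV[R]_0).

Lemma lebesgue_cV_prod (R : realType) (d : nat) (A : 'I_d -> set R) :
  (forall i, measurable (A i)) ->
  lebesgue_cV R d [set x | forall i, A i (x i 0)] =
  (\prod_(i < d) lebesgue_measure (A i))%E.
Proof.
elim: d A => [|d IH] A mA.
  rewrite big_ord0 /= diracE mem_set//; by case.
rewrite big_ord_recl -(IH (fun i => A (lift ord0 i)))//.
have mB : measurable [set x : 'cV[R]_d | forall i, A (lift ord0 i) (x i 0)].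
  rewrite [X in measurable X](_ : _ = \bigcap_(i in [set: 'I_d])
      ((fun x : 'cV[R]_d => x i 0) @^-1` A (lift ord0 i))); last first.
    by apply/seteqP; split=> x Ax i; [move=> _; exact: Ax | exact: (Ax i Logic.I)].
  apply: fin_bigcap_measurable => // i _.
  by rewrite -[X in measurable X]setTI; exact: measurable_coord.
rewrite /= /lebesgue_cons /pushforward -product_measure1E//; last exact: mA.
congr ((_ \x _)%E _); apply/seteqP; split=> -[x y] /=.
  move=> Axy; split; first by have := Axy ord0; rewrite cV_cons0.
  by move=> i; have := Axy (lift ord0 i); rewrite cV_consS.
move=> [Ax Ay] i; case: (unliftP ord0 i) => [j|] ->.
  by rewrite cV_consS; exact: Ay.
by rewrite cV_cons0.
Qed.

Section wiener_algebra.
Context {R : realType}.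

Definition cube (d : nat) : set 'cV[R]_d :=
  [set x | forall i, - pi <= x i 0 <= pi].
Arguments cube : clear implicits.

Definition inner (d : nat) (x y : 'cV[R]_d) : R := \sum_(i < d) x i 0 * y i 0.

Definition expi (theta : R) : R[i] := cos theta +i* sin theta.

(* functions on the torus are functions on R^d that are 2pi-periodic in each
   variable *)
Definition periodic (d : nat) (T : Type) (f : 'cV[R]_d -> T) : Prop :=
  forall (i : 'I_d) (x : 'cV[R]_d), f (x + (2 * pi) *: delta_mx i 0) = f x.

(* the integral over the torus, with the cube as fundamental domain *)
Definition torus_integral (d : nat) (f : 'cV[R]_d -> R[i]) : R[i] :=
  (\int[lebesgue_cV R d]_(t in cube d) complex.Re (f t)) +i*
  (\int[lebesgue_cV R d]_(t in cube d) complex.Im (f t)).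

Definition fourier_coef (d : nat) (f : 'cV[R]_d -> R[i]) (n : 'cV[int]_d) :
    R[i] :=
  (((2 * pi) ^+ d)^-1)%:C *
  torus_integral (fun t => f t * expi (- inner (map_mx intr n) t)).

Definition A_norm (d : nat) (f : 'cV[R]_d -> R[i]) : \bar R :=
  \esum_(n in [set: 'cV[int]_d]) (Normc.normc (fourier_coef f n))%:E.

(* the regular module R[i]^o carries the topology of the modulus on R[i] *)
Definition in_A (d : nat) (f : 'cV[R]_d -> R[i]) : Prop :=
  [/\ periodic f, continuous (f : 'cV[R]_d -> R[i]^o) & (A_norm f < +oo)%E].

Definition class_A (p q : nat) (s : 'cV[R]_p -> 'cV[R]_q) : Prop :=
  forall j : 'I_q, in_A (fun x => (s x j 0)%:C).

Definition domain (d : nat) (J : set 'cV[R]_d) : Prop :=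
  [/\ J !=set0, connected J & open J].

Definition phase (k m : nat) (a : 'cV[R]_k -> 'cV[R]_m)
    (b : 'cV[R]_m -> 'cV[R]_m) (z : 'cV[R]_(k + m)) : R :=
  inner (a (usubmx z)) (b (dsubmx z)).

End wiener_algebra.
Arguments cube {R} d.

(* Main.v *)
Require Import Defs.
From mathcomp Require Import all_boot all_order all_algebra.
From mathcomp Require Import all_classical all_reals all_analysis.
From mathcomp Require Import complex.
From mathcomp Require Import measurable_realfun.
From mathcomp Require Import zify ring lra.

Set Implicit Arguments.
Unset Strict Implicit.
Unset Printing Implicit Defensive.
Import Order.TTheory GRing.Theory Num.Theory.
Import numFieldNormedType.Exports.

Local Open Scope classical_set_scope.
Local Open Scope ring_scope.

(** Write [mu] for the gradient [P^T a(x)] of the phase in the variable [y]: for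
    [y] in [J] the function [y |-> exp (i lambda phase (x, y))] is, up to a
    factor of modulus 1, the pure wave of frequency [lambda mu].  When [x]
    varies, this frequency sweeps a set of measure of order [|lambda|^m], hence
    comes within distance 1 of at least [c |lambda|^m] integer vectors [n].
    The claim is that each such [n] is responsible for an amount of Fourier mass
    that does not depend on [lambda]: the sum of the moduli of the coefficients
    whose [y]-frequency lies within a fixed distance [N] of [n] is at least
    [cos 1 / 2] ([frequency_mass]).  Since every [y]-frequency is within [N] of at
    most [(2 N + 1)^m] integer vectors ([count_near]), summing over [n] bounds the
    [A]-norm from below by a multiple of the number of vectors [n].

    The mass near [n] is detected by testing against a non-negative
    trigonometric polynomial, the product over the coordinates of the kernels
    [cos ((z_i - w_i) / 2) ^ (2 N_i)].  Two properties of these kernels are used.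
    - Their Fourier coefficients are binomial coefficients divided by [4^N], so
      none of them exceeds the central one, which is the mean of the kernel.
      Consequently the integral of a function against the normalized kernel is at
      most the sum of the moduli of finitely many of its coefficients
      ([integral_cos_kernel_le]); no Fourier inversion is needed.
    - They concentrate at [w] when the [N_i] grow ([cos_pow_concentrates]).  If the
      function is [exp (i A)] and [|A| <= 1] close to [w], its integral against the
      normalized kernel has real part at least [cos 1 / 2]
      ([integral_cos_kernel_ge]).

    The centre [w] is [(x1, yc)], where [lambda mu] is close to [n] at [x1] and
    [yc] is a point of [J].  In the [y]-coordinates the phase
    [lambda phase - (n, y)] has a gradient bounded by 2 in each coordinate, so a
    neighbourhood of [yc] that does not depend on [lambda] or [n] makes [A] small,
    and there [N_i] is fixed once and for all.  In the [x]-coordinates only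
    continuity of [a] is available, and the exponents [N_i] depend on [lambda] and
    [n]; this is harmless because the frequencies in [x] are not counted.

    The number of vectors [n] is bounded below by covering the image of [a] with
    the sets where [|lambda P^T v - n| <= 1], each contained in a box of side
    [C / |lambda|] ([measure_cover]). *)

(** * Topology and Borel sets of matrix spaces *)

(** The sigma-algebra on matrices is generated by the coordinates; it contains
    the open sets because an open set is the union of the countably many
    rational boxes that it contains. *)
Lemma open_measurable_mx (R : realType) (m n : nat) (U : set 'M[R]_(m, n)) :
  open U -> measurable U.
Proof.
move=> oU.
pose box (p : 'M[rat]_(m, n) * rat) : set 'M[R]_(m, n) :=
  [set x | forall i j, `|x i j - ratr (p.1 i j)| < ratr p.2].
have mbox p : measurable (box p).
  rewrite [X in measurable X](_ : _ = \bigcap_(i in [set: 'I_m])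
     \bigcap_(j in [set: 'I_n])
      ((fun x : 'M[R]_(m, n) => x i j) @^-1` ball (ratr (p.1 i j) : R) (ratr p.2))); last first.
    apply/seteqP; split => x /=.
      by move=> xp i _ j _; rewrite /ball/= distrC.
    by move=> xp i j; have := xp i Logic.I j Logic.I; rewrite /ball/= distrC.
  apply: fin_bigcap_measurable => // i _; apply: fin_bigcap_measurable => // j _.
  rewrite -[X in measurable X]setTI; apply: measurable_coord => //.
  exact: open_measurable (ball_open _ _).
rewrite (_ : U = \bigcup_(p in [set p | box p `<=` U]) box p); last first.
  apply/seteqP; split=> [x Ux|x [p /=]]; last exact.
  have /nbhs_ballP[e /= e0 eU] : nbhs x U by exact: open_nbhs_nbhs.
  have [r /andP[r0 re]] : exists r : rat, (0 < (ratr r : R)) && (ratr r < e / 2).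
    have /rat_in_itvoo[r] : 0 < e / 2 by rewrite divr_gt0.
    by rewrite in_itv/=; exists r.
  have exq (ij : 'I_m * 'I_n) : exists q : rat, `|x ij.1 ij.2 - ratr q| < ratr r.
    have /rat_in_itvoo[q] : x ij.1 ij.2 - ratr r < x ij.1 ij.2 + ratr r by lra.
    by rewrite in_itv/= => /andP[? ?]; exists q; rewrite ltr_norml; lra.
  have [q qP] := choice exq.
  exists (\matrix_(i, j) q (i, j), r); last first.
    by move=> i j; rewrite /= mxE; exact: (qP (i, j)).
  move=> y ybox; apply: eU; split => // i j.
  have := ybox i j; have := qP (i, j); rewrite /= !mxE /ball/= => h1 h2.
  rewrite (_ : x i j - y i j = (x i j - ratr (q (i, j))) - (y i j - ratr (q (i, j)))); last by ring.
  by apply: le_lt_trans (ler_normB _ _) _; lra.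
rewrite bigcup_mkcond; apply: countable_bigcupT_measurable => [|p].
  exact: countableP.
by case: ifP => // _; exact: mbox.
Qed.

Lemma compact_measurable_mx (R : realType) (m n : nat) (K : set 'M[R]_(m, n)) :
  compact K -> measurable K.
Proof.
move=> cK; have /closed_openC : closed K.
  by apply: compact_closed => //; exact: norm_hausdorff.
by move=> /open_measurable_mx/measurableC; rewrite setCK.
Qed.

Lemma continuous_measurable_mx (R : realType) (m n : nat) (f : 'M[R]_(m, n) -> R) :
  continuous f -> measurable_fun setT f.
Proof.
move=> /continuousP cf; apply: (measurability _ (RGenOpens.measurableE R)).
move=> _ [_ [a [b ->] <-]]; rewrite setTI; apply: open_measurable_mx.
exact/cf/interval_open.
Qed.

(** Tychonoff's theorem is applied to row vectors, and then transposed. *)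
Lemma cube_compact (R : realType) (d : nat) : compact (@cube R d).
Proof.
have cK : compact [set v : 'rV[R]_d | forall i, (`[- pi, pi]%classic : set R) (v ord0 i)].
  by apply: (@rV_compact _ _ (fun=> `[- pi, pi]%classic)) => i; exact: segment_compact.
have -> : @cube R d = trmx @`
    [set v : 'rV[R]_d | forall i, (`[- pi, pi]%classic : set R) (v ord0 i)].
  apply/seteqP; split=> [x cx|_ [v cv <-]] /=.
    by exists (x^T); rewrite ?trmxK// => i /=; rewrite mxE in_itv/= cx.
  by move=> i; have := cv i; rewrite /= in_itv/= mxE.
apply: continuous_compact => //; apply: continuous_subspaceT => v.
move=> A /nbhs_ballP[e e0 eA]; apply/nbhs_ballP; exists e => //= w [_ vw].
by apply: eA; split => // i j; rewrite !mxE; exact: vw.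
Qed.

(** Continuity is given for the complexified coordinates, in the topology of the
    modulus on [R[i]]; the real ball of radius [e] is the trace of the complex one. *)
Lemma class_A_continuous (R : realType) (p q : nat) (s : 'cV[R]_p -> 'cV[R]_q) :
  class_A s -> forall j, continuous (fun x => s x j 0).
Proof.
move=> sA j x A /nbhs_ballP[e e0 eA].
have [_ + _] := sA j => /(_ x).
move=> /(_ (ball ((s x j 0)%:C%C : R[i]^o) (e%:C)%C)) h.
have /h hn : nbhs ((s x j 0)%:C%C : R[i]^o) (ball ((s x j 0)%:C%C : R[i]^o) (e%:C)%C).
  by apply/nbhs_ballP; exists (e%:C)%C => //=; rewrite ltcR.
have hA : (fun y : 'cV[R]_p => (s y j 0)%:C%C : R[i]^o) @^-1`
    ball ((s x j 0)%:C%C : R[i]^o) (e%:C)%C `<=` (fun y => s y j 0) @^-1` A.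
  move=> y xy; apply: eA.
  have {}xy : `|(s x j 0)%:C%C - (s y j 0)%:C%C| < (e%:C)%C := xy.
  rewrite /ball/= -ltcR; move: xy.
  by rewrite -rmorphB/= normc_def /= expr0n/= addr0 sqrtr_sqr.
move: hn; rewrite nbhs_simpl/= => /(@nbhs_ballP R 'cV[R]_p)[r /= r0 hr].
by apply/nbhs_ballP; exists r => //; apply: subset_trans hr hA.
Qed.

Lemma continuous_mx (R : realType) (p q : nat) (s : 'cV[R]_p -> 'cV[R]_q) :
  (forall j, continuous (fun x => s x j 0)) -> continuous s.
Proof.
move=> cs x A [B nB BA]; rewrite nbhs_simpl/=.
have /(@nbhs_ballP R 'cV[R]_p)[r /= r0 hr] : nbhs x [set y | forall i, B i 0 (s y i 0)].
  by apply: (filter_forall (@nbhs_filter 'cV[R]_p x)) => i; exact: (cs i x _ (nB i 0)).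
by apply/nbhs_ballP; exists r => // y /hr By; apply: BA => i j; rewrite ord1.
Qed.

(** * Even powers of the cosine on the circle *)

Section cosine_kernel.
Context {R : realType}.
Implicit Types (t w u v : R) (N j : nat).

Lemma expiD u v : expi (u + v) = expi u * expi v.
Proof. by rewrite /expi cosD sinD; simpc; congr (_ +i* _)%C; rewrite addrC. Qed.

Lemma expi0 : expi 0 = 1 :> R[i].
Proof. by rewrite /expi cos0 sin0. Qed.

Lemma expi_sum (I : Type) (r : seq I) (F : I -> R) :
  expi (\sum_(i <- r) F i) = \prod_(i <- r) expi (F i).
Proof. by apply: (big_morph expi expiD expi0). Qed.

Lemma expiX u N : expi u ^+ N = expi (u *+ N).
Proof.
by elim: N => [|N IH]; rewrite ?expr0 ?mulr0n ?expi0// exprS IH -expiD mulrS.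
Qed.

(** The Fourier coefficient of [cos (u / 2) ^ (2 N)] at the frequency [N - j]. *)
Definition cos_coef N j : R := 'C(N.*2, j)%:R / 4 ^+ N.

(** The binomial formula for [((exp (i u / 2) + exp (- i u / 2)) / 2) ^ (2 N)]. *)
Lemma cos_powE N u :
  ((cos (u / 2) ^+ N.*2)%:C)%C =
  \sum_(j < N.*2.+1) (cos_coef N j)%:C%C * expi ((N%:Z - j%:Z)%:~R * u).
Proof.
rewrite rmorphXn/=.
have -> : ((cos (u / 2))%:C = (expi (u / 2) + expi (- (u / 2))) * (2^-1)%:C)%C.
  by rewrite /expi cosN sinN; simpc; congr (_ +i* _)%C; lra.
rewrite exprMn exprDn mulr_suml; apply: eq_bigr => j _.
rewrite 2!expiX -expiD -rmorphXn/=.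
have -> : u / 2 *+ (N.*2 - j) + - (u / 2) *+ j = (N%:Z - j%:Z)%:~R * u.
  have jN : (j <= N.*2)%N by rewrite -ltnS.
  have -> : (N%:Z - j%:Z)%:~R = N%:R - j%:R :> R by rewrite rmorphB.
  rewrite mulNrn -[u / 2 *+ (_ - _)]mulr_natr -[u / 2 *+ j]mulr_natr natrB//.
  have -> : N.*2%:R = N%:R * 2 :> R by rewrite -muln2 natrM.
  move: (N%:R : R) (j%:R : R) => x y.
  by field.
rewrite -[_ *+ 'C(_, _)]mulr_natl mulrAC; congr (_ * _).
rewrite -(rmorph_nat (real_complex R)) -rmorphM/= /cos_coef; congr (_%:C)%C; congr (_ * _).
by rewrite -exprVn -muln2 mulnC exprM; congr (_ ^+ _); field.
Qed.

Lemma cos_coef_ge0 N j : 0 <= cos_coef N j.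
Proof. by rewrite divr_ge0// exprn_ge0. Qed.

Lemma cos_coef_gt0 N : 0 < cos_coef N N.
Proof. by rewrite divr_gt0 ?exprn_gt0// ltr0n bin_gt0 -addnn leq_addr. Qed.

(** Binomial coefficients are unimodal: [C (2 N, j)] increases up to [j = N], and
    the other half follows by symmetry. *)
Lemma cos_coef_max N j : cos_coef N j <= cos_coef N N.
Proof.
rewrite ler_pM2r ?invr_gt0 ?exprn_gt0// ler_nat.
have step i : (i < N)%N -> ('C(N.*2, i) <= 'C(N.*2, i.+1))%N.
  move=> iN; have := mul_bin_left N.*2 i => e.
  have : (i.+1 * 'C(N.*2, i) <= i.+1 * 'C(N.*2, i.+1))%N.
    by rewrite e leq_mul2r; apply/orP; right; lia.
  by rewrite leq_pmul2l.
have up i : (i <= N)%N -> ('C(N.*2, i) <= 'C(N.*2, N))%N.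
  move=> iN; rewrite -(subKn iN); elim: (N - i)%N (leq_subr i N) => [|k IH] kN.
    by rewrite subn0.
  apply: leq_trans (IH _); last lia.
  by rewrite (_ : (N - k = (N - k.+1).+1)%N); [apply: step; lia|lia].
have [/up//|Nj] := leqP j N.
have [jN|jN] := leqP j N.*2; last by rewrite bin_small.
by rewrite -(bin_sub jN); apply: up; lia.
Qed.

Lemma integral_cos_int (l : int) w : l != 0 ->
  (\int[lebesgue_measure]_(t in `[(- pi)%R, pi%R]) (cos (l%:~R * (t - w)))%:E = 0)%E.
Proof.
move=> l0; have lR : l%:~R != 0 :> R by rewrite intr_eq0.
pose F t : R := (l%:~R)^-1 * sin (l%:~R * (t - w)).
have dF t : is_derive t 1 F (cos (l%:~R * (t - w))).
  apply: is_derive_eq.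
  by rewrite /GRing.scale/= subr0 mulr1; field.
have cF : continuous F.
  by move=> t; apply: differentiable_continuous; apply/derivable1_diffP; case: (dF t).
have cf : continuous (fun t => cos (l%:~R * (t - w))).
  move=> t; apply: continuous_comp; last exact: continuous_cos.
  by apply: cvgM; [exact: cvg_cst|apply: cvgB; [exact: cvg_id|exact: cvg_cst]].
rewrite (@continuous_FTC2 _ _ F).
- rewrite -EFinB; congr (_%:E); rewrite /F -mulrBr; apply/eqP.
  rewrite mulf_eq0 invr_eq0 (negPf lR)/= mulrBr mulrBr mulrN.
  rewrite sinB -opprD sinN sinD.
  suff -> : sin (l%:~R * pi) = 0 :> R by apply/eqP; ring.
  suff H n : sin (n%:R * pi) = 0 :> R.
    case: l {l0 lR F dF cF cf} => n; first by rewrite -pmulrn H.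
    by rewrite NegzE mulrNz mulNr sinN -pmulrn H oppr0.
  elim: n => [|n IH]; first by rewrite mul0r sin0.
  by rewrite -natr1 mulrDl mul1r sinDpi IH oppr0.
- by rewrite gtrN// pi_gt0.
- exact: continuous_subspaceT.
- split; [by move=> x _; case: (dF x)| |].
  + exact/cvg_at_right_filter/cF.
  + exact/cvg_at_left_filter/cF.
- by move=> x _; rewrite derive1E; exact: derive_val.
Qed.

Lemma Re_sum (I : Type) (r : seq I) (F : I -> R[i]) :
  complex.Re (\sum_(i <- r) F i) = \sum_(i <- r) complex.Re (F i).
Proof. by apply: (big_morph (@complex.Re R)) => // -[a b] [c d]. Qed.

Lemma cos_pow_cosE N u :
  cos (u / 2) ^+ N.*2 = \sum_(j < N.*2.+1) cos_coef N j * cos ((N%:Z - j%:Z)%:~R * u).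
Proof.
have /(congr1 (@complex.Re R)) /= -> := cos_powE N u.
by rewrite Re_sum; apply: eq_bigr => j _; rewrite /= mul0r subr0.
Qed.

Lemma measurable_cos : measurable_fun setT (@cos R).
Proof. by apply: continuous_measurable_fun; exact: continuous_cos. Qed.

Lemma measurable_cos_pow N w : measurable_fun setT (fun t => cos ((t - w) / 2) ^+ N.*2).
Proof.
apply: measurable_funX; apply: measurableT_comp; first exact: measurable_cos.
by apply: measurable_funM => //; apply: measurable_funB.
Qed.

Lemma cos_pow_ge0 N t : 0 <= cos t ^+ N.*2.
Proof. by rewrite -muln2 mulnC exprM exprn_ge0// sqr_ge0. Qed.

Lemma lebesgue_measure_2pi : lebesgue_measure (`[- pi, pi]%classic : set R) = (2 * pi)%:E.
Proof.
have := @pi_gt0 R.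
by rewrite lebesgue_measure_itv/= lte_fin => h; rewrite ifT; [rewrite -EFinB; congr _%:E; ring|lra].
Qed.

(** Only the constant term of the expansion has a non-zero integral. *)
Lemma integral_cos_pow N w :
  (\int[lebesgue_measure]_(t in `[(- pi)%R, pi%R]) (cos ((t - w) / 2) ^+ N.*2)%:E =
   (2 * pi * cos_coef N N)%:E)%E.
Proof.
have icos (c : R) (l : int) : (@lebesgue_measure R).-integrable `[- pi, pi]
    (EFin \o (fun t => c * cos (l%:~R * (t - w)))).
  apply: measurable_bounded_integrable => //.
  - by rewrite [X in (X < _)%E]lebesgue_measure_2pi ltry.
  - apply: measurable_funM => //; apply: measurableT_comp; first exact: measurable_cos.
    by apply: measurable_funM => //; apply: measurable_funB.
  - exists `|c|; split => // x cx t _ /=; rewrite normrM.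
    apply: le_trans (ltW cx); rewrite -[leRHS]mulr1.
    by rewrite ler_wpM2l// cos_max.
under eq_integral do rewrite cos_pow_cosE -sumEFin.
rewrite integral_sum//=; last by move=> j; exact: icos.
have jN : (N < N.*2.+1)%N by rewrite ltnS -addnn leq_addr.
rewrite (bigD1 (Ordinal jN))//= big1 ?adde0.
  under eq_integral do rewrite subrr mul0r cos0 mulr1.
  by rewrite integral_cst// [X in (_ * X)%E]lebesgue_measure_2pi -EFinM mulrC.
move=> j jneq; under eq_integral do rewrite EFinM.
rewrite integralZl//; last first.
  rewrite (_ : (fun t => _) = EFin \o (fun t => 1 * cos ((N%:Z - j%:Z)%:~R * (t - w)))).
    exact: icos.
  by apply/funext => t /=; rewrite mul1r.
rewrite integral_cos_int ?mule0//.
by rewrite subr_eq0; apply: contra jneq => /eqP[Nj]; apply/eqP/val_inj.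
Qed.

(** At [u = 0] the expansion writes 1 as a sum of [2 N + 1] coefficients, none of
    which exceeds the central one. *)
Lemma cos_coef_lb N : 1 <= (N.*2.+1)%:R * cos_coef N N.
Proof.
have := cos_pow_cosE N 0; rewrite mul0r cos0 expr1n => {1}->.
rewrite mulr_natl -[X in _ *+ X](card_ord N.*2.+1).
rewrite -sumr_const; apply: ler_sum => j _.
by rewrite mulr0 cos0 mulr1 cos_coef_max.
Qed.

(** With [q = sqrt r], Bernoulli's inequality bounds [N q ^ N], and the remaining
    factor [q ^ N] tends to 0. *)
Lemma linear_mul_geometric_small (r e : R) : 0 <= r < 1 -> 0 < e ->
  exists N, (N.*2.+1)%:R * r ^+ N <= e.
Proof.
move=> /andP[r0 r1] e0.
have [->|rn0] := eqVneq r 0.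
  by exists 1%N; rewrite expr1 mulr0 ltW.
have {rn0}r0 : 0 < r by rewrite lt_def rn0.
pose q := Num.sqrt r.
have q0 : 0 < q by rewrite sqrtr_gt0.
have q1 : q < 1 by rewrite -[ltRHS]sqrtr1 ltr_sqrt.
(* [q^-1 = 1 + h], to which Bernoulli's inequality applies *)
pose h := q^-1 - 1.
have h0 : 0 < h by rewrite subr_gt0 invf_gt1.
have bern N : N%:R * h * q ^+ N <= 1.
  have : 1 + N%:R * h <= q^-1 ^+ N.
    elim: N => [|N IH]; first by rewrite mul0r addr0 expr0.
    rewrite exprS -natr1; apply: (@le_trans _ _ (q^-1 * (1 + N%:R * h))).
      rewrite (_ : q^-1 = 1 + h); last by rewrite /h; ring.
      have := mulr_ge0 (ler0n R N) (sqr_ge0 h); rewrite expr2 => hh.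
      by nra.
    by rewrite ler_pM2l ?invr_gt0.
  have qN0 : 0 < q ^+ N by rewrite exprn_gt0.
  rewrite exprVn => /(ler_wpM2r (ltW qN0)).
  by rewrite mulVf ?gt_eqF// mulrDl mul1r => ?; lra.
have C0 : 0 < 2 / h + 1 by rewrite addr_gt0// divr_gt0.
have q1' : `|q| < 1 by rewrite gtr0_norm.
have /cvgrPdist_lt /(_ (e / (2 / h + 1)))[|N _ HN] := cvg_expr q1'.
  by rewrite divr_gt0.
exists N; have := HN N (leqnn N); rewrite /= sub0r normrN => qN.
have qNn : 0 <= q ^+ N by rewrite exprn_ge0 ?ltW.
have qN1 : q ^+ N <= 1 by rewrite exprn_ile1 ?ltW.
rewrite (_ : r = q * q); last by rewrite -expr2 sqr_sqrtr ?ltW.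
rewrite exprMn mulrA.
have : N.*2.+1%:R * q ^+ N <= 2 / h + 1.
  rewrite -natr1 mulrDl mul1r; apply: lerD => //.
  rewrite ler_pdivlMr// -muln2 natrM; have := bern N; nra.
move=> le1; apply: (@le_trans _ _ ((2 / h + 1) * q ^+ N)).
  by rewrite ler_wpM2r.
by rewrite -ler_pdivlMl// mulrC; move: qN; rewrite ger0_norm// => /ltW.
Qed.

Lemma cos_le (x y : R) : 0 <= x -> x <= y -> y <= pi -> cos y <= cos x.
Proof.
move=> x0; rewrite le_eqVlt => /predU1P[->//|xy] ypi.
by rewrite ltW// ltr_cos// in_itv/=; apply/andP; split; lra.
Qed.

Lemma measurable_far w rho :
  measurable_fun setT (fun t => (rho <= `|t - w|)%R%:R : R).
Proof.
rewrite (_ : (fun t => _) = \1_(~` ball w rho)); last first.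
  apply/funext => t; rewrite indicE in_setC; congr (_%:R); congr nat_of_bool.
  apply/idP/idP; rewrite ?notin_setE /ball/= distrC leNgt.
    by move=> /negP.
  by move=> /negP.
by apply: measurable_indic; apply: measurableC; exact: open_measurable (ball_open _ _).
Qed.

(** Away from [w] the kernel is at most [r ^ N] with [r = cos (rho / 2) ^ 2 < 1],
    whereas its mass [2 pi cos_coef N N] is at least [2 pi / (2 N + 1)].  The
    interval [[w - rho, w + rho]] has to lie in [[- pi, pi]]: otherwise
    [t - w] comes close to [2 pi] or [- 2 pi], where the kernel peaks again. *)
Lemma cos_pow_concentrates (w rho e : R) : - pi <= w - rho -> w + rho <= pi -> 0 < rho ->
  0 < e -> exists N,
  (\int[lebesgue_measure]_(t in `[(- pi)%R, pi%R])
      (((rho <= `|t - w|)%R%:R * cos ((t - w) / 2) ^+ N.*2)%:E) <=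
   (e * (2 * pi * cos_coef N N))%:E)%E.
Proof.
move=> w1 w2 rho0 e0.
pose r : R := cos (rho / 2) ^+ 2.
have pi0 := @pi_gt0 R.
have r01 : 0 <= r < 1.
  rewrite sqr_ge0 /= /r.
  have c1 : cos (rho / 2) < 1.
    by rewrite -[ltRHS]cos0 ltr_cos ?in_itv/=; first lra; apply/andP; split; lra.
  have c0 : 0 <= cos (rho / 2) by apply: cos_ge0_pihalf; apply/andP; split; lra.
  by rewrite expr_lt1.
have [N HN] := linear_mul_geometric_small r01 e0.
exists N.
apply: (@le_trans _ _ (\int[lebesgue_measure]_(t in `[(- pi)%R, pi%R]) (cst (r ^+ N)%:E t))%E).
  apply: ge0_le_integral => //.
  - by move=> t _; rewrite lee_fin mulr_ge0// cos_pow_ge0.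
  - apply/measurable_EFinP; apply: measurable_funTS.
    apply: measurable_funM; last exact: measurable_cos_pow.
    exact: measurable_far.
  - move=> t /=; rewrite in_itv/= => /andP[t1 t2]; rewrite lee_fin.
    have [h|_] := leP rho `|t - w|; last by rewrite mul0r exprn_ge0// (andP r01).1.
    rewrite mul1r -muln2 mulnC exprM lerXn2r ?nnegrE ?sqr_ge0//.
    rewrite -cos_norm normrM (@ger0_norm _ 2^-1)//.
    (* the half angle lies in [[rho / 2, pi - rho / 2]], where |cos| <= cos (rho / 2) *)
    have u1 : `|t - w| <= 2 * pi - rho by rewrite ler_norml; apply/andP; split; lra.
    have : `|cos (`|t - w| / 2)| <= cos (rho / 2).
      rewrite ler_norml lerNl; apply/andP; split; last by apply: cos_le; lra.
      by rewrite -[in leLHS]cosN -cosDpi; apply: cos_le; lra.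
    move=> le1; rewrite -[leLHS]real_normK ?num_real// lerXn2r ?nnegrE//.
    by apply: cos_ge0_pihalf; apply/andP; split; lra.
rewrite integral_cst// [X in (_ * X)%E]lebesgue_measure_2pi -EFinM lee_fin.
rewrite mulrC mulrCA ler_pM2l; last by rewrite mulr_gt0.
apply: (@le_trans _ _ (r ^+ N * (N.*2.+1%:R * cos_coef N N))).
  by rewrite -[leLHS]mulr1 ler_wpM2l ?cos_coef_lb// exprn_ge0// (andP r01).1.
by rewrite mulrA ler_pM2r ?cos_coef_gt0// mulrC.
Qed.
End cosine_kernel.

(** * Integrals over the cube *)

Section cube_integral.
Context {R : realType}.

(** The measure on column vectors is an iterated product, so Tonelli's theorem
    separates one coordinate at a time. *)
Lemma integral_cV_prod (d : nat) (f : 'I_d -> R -> R) :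
  (forall i, measurable_fun setT (f i)) -> (forall i t, 0 <= f i t) ->
  (\int[lebesgue_cV R d]_z (\prod_(i < d) f i (z i 0))%:E =
   \prod_(i < d) \int[lebesgue_measure]_t (f i t)%:E)%E.
Proof.
elim: d f => [|d IH] f mf f0.
  rewrite big_ord0 /=; under eq_integral do rewrite big_ord0.
  rewrite integral_cst// mul1e. exact: diracT.
rewrite big_ord_recl -(IH (fun i => f (lift ord0 i)))//.
have mprod : measurable_fun setT (fun z : 'cV[R]_d =>
    \prod_(i < d) f (lift ord0 i) (z i 0)).
  apply: measurable_prod => i _.
  exact: measurableT_comp (mf _) (measurable_coord _ _).
have mprod1 : measurable_fun setT (fun z : 'cV[R]_d.+1 =>
    \prod_(i < d.+1) f i (z i 0)).
  apply: measurable_prod => i _.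
  exact: measurableT_comp (mf _) (measurable_coord _ _).
rewrite /= /lebesgue_cons ge0_integral_pushforward//=; first last.
- by move=> z _; rewrite lee_fin prodr_ge0.
- exact/measurable_EFinP.
- exact: measurable_cV_cons.
rewrite preimage_setT fubini_tonelli1//=; first last.
- by move=> z; rewrite lee_fin prodr_ge0.
- apply/measurable_EFinP; apply: (measurableT_comp mprod1); exact: measurable_cV_cons.
pose c := (\int[lebesgue_cV R d]_z (\prod_(i < d) f (lift ord0 i) (z i 0))%:E)%E.
transitivity (\int[lebesgue_measure]_t ((f ord0 t)%:E * c))%E.
  apply: eq_integral => t _; rewrite /fubini_F/=.
  under eq_integral.
    move=> z _; rewrite big_ord_recl cV_cons0/= EFinM.
    under eq_bigr do rewrite cV_consS.
    over.
  rewrite ge0_integralZl_EFin//; first by move=> z _; rewrite lee_fin prodr_ge0.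
  exact/measurable_EFinP.
rewrite ge0_integralZr//.
- by apply/measurable_EFinP; exact: mf.
- by move=> t _; rewrite lee_fin.
- by apply: integral_ge0 => z _; rewrite lee_fin prodr_ge0.
Qed.

Lemma cubeE d : @cube R d = [set x | forall i, (`[- pi, pi]%classic : set R) (x i 0)].
Proof. by apply/seteqP; split => x /= h i; have := h i; rewrite in_itv. Qed.

Lemma measurable_cube d : measurable (@cube R d).
Proof. by apply: compact_measurable_mx; exact: cube_compact. Qed.

Lemma cube_measure d : lebesgue_cV R d (cube d) = ((2 * pi) ^+ d)%:E.
Proof.
rewrite cubeE (@lebesgue_cV_prod R d (fun=> `[- pi, pi]%classic)); last by move=> i; exact: measurable_itv.
under eq_bigr do rewrite lebesgue_measure_2pi.
by rewrite prodEFin prodr_const card_ord.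
Qed.

Lemma integral_cube_prod (d : nat) (f : 'I_d -> R -> R) :
  (forall i, measurable_fun setT (f i)) -> (forall i t, 0 <= f i t) ->
  (\int[lebesgue_cV R d]_(z in cube d) (\prod_(i < d) f i (z i 0))%:E =
   \prod_(i < d) \int[lebesgue_measure]_(t in `[(- pi)%R, pi%R]) (f i t)%:E)%E.
Proof.
move=> mf f0; rewrite integral_mkcond.
under [RHS]eq_bigr do rewrite integral_mkcond.
pose I : set R := `[- pi, pi]%classic.
transitivity (\int[lebesgue_cV R d]_z (\prod_(i < d) (f i \_ I) (z i 0))%:E)%E.
  apply: eq_integral => z _; rewrite !patchE.
  case: ifPn => [|].
    rewrite inE cubeE => zI; congr (_%:E); apply: eq_bigr => i _.
    by rewrite patchE mem_set//; exact: zI.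
  rewrite notin_setE cubeE => /existsNP[i ziI].
  by rewrite (bigD1 i)//= patchE memNset// mul0r.
rewrite (@integral_cV_prod _ (fun i => f i \_ I)).
- apply: eq_bigr => i _; apply: eq_integral => t _.
  by rewrite !patchE; case: ifP.
- by move=> i; apply/(measurable_restrictT _ _).1; [exact: measurable_itv|apply: measurable_funTS; exact: mf].
- by move=> i t; rewrite patchE; case: ifP.
Qed.

Lemma cube_integrable d (f : 'cV[R]_d -> R) (C : R) :
  measurable_fun setT f -> (forall z, `|f z| <= C) ->
  (lebesgue_cV R d).-integrable (cube d) (EFin \o f).
Proof.
move=> mf fC; apply: measurable_bounded_integrable.
- exact: measurable_cube.
- by rewrite [X in (X < _)%E]cube_measure ltry.
- exact: measurable_funTS.
- by exists C; split; [exact: num_real|move=> x Cx z _ /=; exact: le_trans (fC z) (ltW Cx)].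
Qed.

Lemma measurable_inner d (n : 'cV[R]_d) : measurable_fun setT (inner n).
Proof.
apply: measurable_sum => i _; apply: measurable_funM => //.
exact: measurable_coord.
Qed.

Lemma measurable_sin : measurable_fun setT (@sin R).
Proof. by apply: continuous_measurable_fun; exact: continuous_sin. Qed.

Lemma cauchy_schwarz2 (X Y theta : R) :
  X * cos theta + Y * sin theta <= Num.sqrt (X ^+ 2 + Y ^+ 2).
Proof.
apply: le_trans (ler_norm _) _; rewrite -sqrtr_sqr ler_wsqrtr//.
have := cos2Dsin2 theta; move: (cos theta) (sin theta) => c s h.
have -> : X ^+ 2 + Y ^+ 2 = (X ^+ 2 + Y ^+ 2) * (c ^+ 2 + s ^+ 2) by rewrite h mulr1.
have := sqr_ge0 (X * s - Y * c); nra.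
Qed.

(** The left-hand side is the real part of [exp (- i theta)] times the integral
    that defines the coefficient. *)
Lemma norm_fourier_coef_ge d (Phi : 'cV[R]_d -> R) (n : 'cV[int]_d) (theta : R) :
  measurable_fun setT Phi ->
  \int[lebesgue_cV R d]_(z in cube d)
     cos (Phi z - inner (map_mx intr n) z - theta) <=
  (2 * pi) ^+ d * Normc.normc (fourier_coef (fun z => expi (Phi z)) n).
Proof.
move=> mPhi; pose B z := Phi z - inner (map_mx intr n) z.
have mB : measurable_fun setT B.
  by apply: measurable_funB => //; exact: measurable_inner.
have icos : (lebesgue_cV R d).-integrable (cube d) (EFin \o (fun z => cos (B z))).
  apply: (@cube_integrable _ _ 1); last by move=> z; exact: cos_max.
  exact: measurableT_comp measurable_cos mB.
have isin : (lebesgue_cV R d).-integrable (cube d) (EFin \o (fun z => sin (B z))).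
  apply: (@cube_integrable _ _ 1); last by move=> z; exact: sin_max.
  exact: measurableT_comp measurable_sin mB.
have mc : measurable (@cube R d) by exact: measurable_cube.
pose X := \int[lebesgue_cV R d]_(z in cube d) cos (B z).
pose Y := \int[lebesgue_cV R d]_(z in cube d) sin (B z).
have -> : \int[lebesgue_cV R d]_(z in cube d)
    cos (Phi z - inner (map_mx intr n) z - theta) = X * cos theta + Y * sin theta.
  rewrite /X /Y -!RintegralZr//.
  rewrite -RintegralD//.
  - by apply: eq_Rintegral => z _; rewrite cosB.
  - exact: (integrableZr mc (cos theta) icos).
  - exact: (integrableZr mc (sin theta) isin).
have -> : fourier_coef (fun z => expi (Phi z)) n =
    ((((2 * pi) ^+ d)^-1)%:C * (X +i* Y))%C.
  rewrite /fourier_coef /torus_integral; congr (_ * (_ +i* _))%C.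
    by apply: eq_Rintegral => z _; rewrite -expiD.
  by apply: eq_Rintegral => z _; rewrite -expiD.
rewrite Normc.normcM.
have pd : 0 < (2 * pi) ^+ d :> R by rewrite exprn_gt0// mulr_gt0// pi_gt0.
rewrite [Normc.normc (_%:C)%C]/= expr0n/= addr0 sqrtr_sqr gtr0_norm ?invr_gt0//.
by rewrite mulrA mulfV ?gt_eqF// mul1r; exact: cauchy_schwarz2.
Qed.
End cube_integral.

(** * The product kernel *)

Lemma sum_le_esum (R : realType) (T : choiceType) (I : finType) (P : pred I)
    (g : I -> T) (A : set T) (u : T -> \bar R) :
  {in P &, injective g} -> (forall i, P i -> A (g i)) ->
  (\sum_(i | P i) u (g i) <= \esum_(x in A) u x)%E.
Proof.
move=> ginj gA; apply: esum_ge; exists [set` [seq g i | i <- enum P]].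
  split; first exact: finite_seq.
  by move=> _ /= /mapP[i + ->]; rewrite mem_enum; exact: gA.
rewrite -fsbig_seq; last first.
  by rewrite map_inj_in_uniq ?enum_uniq// => i j; rewrite !mem_enum; exact: ginj.
by rewrite big_map big_enum.
Qed.

Section cube_kernel.
Context {R : realType} (d : nat) (N : 'I_d -> nat) (w : 'cV[R]_d).

Definition cube_kernel (z : 'cV[R]_d) : R :=
  \prod_(i < d) cos ((z i 0 - w i 0) / 2) ^+ (N i).*2.

(** A common bound of the [2 N_i], so that the expansion of the product is indexed
    by functions into a single finite type; the excess indices carry the
    coefficient 0. *)
Definition kernel_degree : nat := \max_(i < d) (N i).*2.

Definition kernel_freq (f : {ffun 'I_d -> 'I_kernel_degree.+1}) : 'cV[int]_d :=
  \col_i ((N i)%:Z - (f i)%:Z).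

Definition kernel_coef (f : {ffun 'I_d -> 'I_kernel_degree.+1}) : R :=
  \prod_(i < d) cos_coef (N i) (f i).

(** The integral of the kernel over the cube, see [integral_kernel]. *)
Definition kernel_mass : R := \prod_(i < d) (2 * pi * cos_coef (N i) (N i)).

Lemma cube_kernel_ge0 z : 0 <= cube_kernel z.
Proof. by apply: prodr_ge0 => i _; exact: cos_pow_ge0. Qed.

Lemma measurable_cube_kernel : measurable_fun setT cube_kernel.
Proof.
apply: measurable_prod => i _.
exact: measurableT_comp (measurable_cos_pow (N i) (w i 0)) (measurable_coord i 0).
Qed.

Lemma cube_kernel_le1 z : `|cube_kernel z| <= 1.
Proof.
rewrite normr_prod; apply: prodr_ile1 => i _; rewrite normr_ge0 normrX.
by rewrite exprn_ile1// cos_max.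
Qed.

Lemma kernel_mass_gt0 : 0 < kernel_mass.
Proof.
by apply: prodr_gt0 => i _; rewrite mulr_gt0 ?cos_coef_gt0// mulr_gt0// pi_gt0.
Qed.

(** Real part of the expansion of [exp (i B)] times the kernel, obtained by
    distributing the product of the one-dimensional expansions. *)
Lemma cos_mul_kernel (B : R) z : cos B * cube_kernel z =
  \sum_f kernel_coef f *
     cos (B + \sum_(i < d) (kernel_freq f i 0)%:~R * (z i 0 - w i 0)).
Proof.
have eK : ((cube_kernel z)%:C = \sum_f (kernel_coef f)%:C *
     expi (\sum_(i < d) (kernel_freq f i 0)%:~R * (z i 0 - w i 0)))%C.
  rewrite /cube_kernel rmorph_prod/=.
  transitivity (\prod_(i < d) \sum_(j < kernel_degree.+1) (cos_coef (N i) j)%:C%C *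
      expi (((N i)%:Z - j%:Z)%:~R * (z i 0 - w i 0))).
    apply: eq_bigr => i _; rewrite cos_powE.
    have Ni : ((N i).*2 < kernel_degree.+1)%N.
      by rewrite ltnS; exact: (leq_bigmax (F := fun i => (N i).*2)).
    rewrite (big_ord_widen _ (fun j => (cos_coef (N i) j)%:C%C *
      expi (((N i)%:Z - j%:Z)%:~R * (z i 0 - w i 0))) Ni).
    rewrite big_mkcond; apply: eq_bigr => j _; case: ifPn => //.
    by rewrite -leqNgt => ij; rewrite /cos_coef bin_small// mul0r mul0r.
  rewrite bigA_distr_bigA; apply: eq_bigr => f _.
  rewrite big_split/= -expi_sum rmorph_prod; congr (_ * expi _).
  by apply: eq_bigr => i _; rewrite mxE.
have : complex.Re (expi B * (cube_kernel z)%:C%C) = cos B * cube_kernel z.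
  by rewrite /= mulr0 subr0.
rewrite eK mulr_sumr Re_sum => <-; apply: eq_bigr => f _.
by rewrite mulrCA -expiD /= mul0r subr0.
Qed.

Lemma integral_kernel :
  \int[lebesgue_cV R d]_(z in cube d) cube_kernel z = kernel_mass.
Proof.
rewrite /Rintegral (@integral_cube_prod _ _ (fun i t => cos ((t - w i 0) / 2) ^+ (N i).*2)).
- by under eq_bigr do rewrite integral_cos_pow; rewrite prodEFin.
- by move=> i; exact: measurable_cos_pow.
- by move=> i t; exact: cos_pow_ge0.
Qed.

Definition far (rho : R) (i : 'I_d) (z : 'cV[R]_d) : R := (rho <= `|z i 0 - w i 0|)%R%:R.

(** The constraint bears on one coordinate only, so the other factors of the
    product integral are those of the total mass. *)
Lemma integral_kernel_far (rho e : R) (i : 'I_d) : 0 <= e ->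
  (\int[lebesgue_measure]_(t in `[(- pi)%R, pi%R])
      (((rho <= `|t - w i 0|)%R%:R * cos ((t - w i 0) / 2) ^+ (N i).*2)%:E) <=
   (e * (2 * pi * cos_coef (N i) (N i)))%:E)%E ->
  \int[lebesgue_cV R d]_(z in cube d) (far rho i z * cube_kernel z) <=
  e * kernel_mass.
Proof.
move=> e0 he.
pose g j t := (if j == i then (rho <= `|t - w i 0|)%R%:R else 1) *
   cos ((t - w j 0) / 2) ^+ (N j).*2.
have -> : \int[lebesgue_cV R d]_(z in cube d) (far rho i z * cube_kernel z) =
   \int[lebesgue_cV R d]_(z in cube d) \prod_j g j (z j 0).
  apply: eq_Rintegral => z _; rewrite /g big_split/=; congr (_ * _).
  by rewrite (bigD1 i)//= eqxx big1 ?mulr1// => j /negPf ->.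
have g0 j t : 0 <= g j t by rewrite mulr_ge0 ?cos_pow_ge0//; case: ifP.
have mg j : measurable_fun setT (g j).
  apply: measurable_funM; last exact: measurable_cos_pow.
  by case: (j == i); [exact: measurable_far|exact: measurable_cst].
have h : (\int[lebesgue_cV R d]_(z in cube d) (\prod_j g j (z j 0))%:E <=
    (e * kernel_mass)%:E)%E.
  have -> : kernel_mass = 2 * pi * cos_coef (N i) (N i) *
      \prod_(j < d | j != i) (2 * pi * cos_coef (N j) (N j)).
    by rewrite /kernel_mass (bigD1 i).
  rewrite integral_cube_prod// (bigD1 i)//= mulrA EFinM.
  apply: lee_pmul.
  - by apply: integral_ge0 => t _; rewrite lee_fin.
  - by apply: prode_ge0 => j _; apply: integral_ge0 => t _; rewrite lee_fin.
  - by apply: le_trans he; rewrite /g eqxx.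
  - rewrite -prodEFin le_eqVlt; apply/orP; left; apply/eqP.
    apply: eq_bigr => j /negPf ji; rewrite /g ji.
    by under eq_integral do rewrite mul1r; exact: integral_cos_pow.
rewrite /Rintegral -lee_fin fineK// ge0_fin_numE.
  by apply: le_lt_trans h _; rewrite ltry.
by apply: integral_ge0 => z _; rewrite lee_fin prodr_ge0.
Qed.
End cube_kernel.

(** * Fourier mass around a frequency *)

Lemma Rintegral_sum d (T : measurableType d) (R : realType)
    (mu : {measure set T -> \bar R}) (D : set T) (I : Type) (r : seq I)
    (f : I -> T -> R) : measurable D ->
  (forall i, mu.-integrable D (EFin \o f i)) ->
  \int[mu]_(x in D) (\sum_(i <- r) f i x) = \sum_(i <- r) \int[mu]_(x in D) f i x.
Proof.
move=> mD fi; rewrite /Rintegral; under eq_integral do rewrite -sumEFin.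
rewrite integral_sum// -EFin_sum_fine// => i _.
by apply: integrable_fin_num => //; exact: fi.
Qed.

Lemma normc_ge0 (R : rcfType) (x : R[i]) : 0 <= Normc.normc x.
Proof. by case: x => x y; exact: sqrtr_ge0. Qed.

(** [exp (i Phi)] is tested at the frequency [n] against the kernel centred at [w];
    [rho i] is the radius around [w i 0] outside of which the kernel is negligible,
    and [theta] is the approximate value of [Phi - (n, z)] near [w]. *)
Section local_fourier_mass.
Context {R : realType} (d : nat) (N : 'I_d -> nat) (w : 'cV[R]_d) (rho : 'I_d -> R).
Variables (Phi : 'cV[R]_d -> R) (n : 'cV[int]_d) (theta : R).

Let A z := Phi z - inner (map_mx intr n) z - theta.
Let coef (L : 'cV[int]_d) : R :=
  Normc.normc (fourier_coef (fun z => expi (Phi z)) L).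

Hypothesis mPhi : measurable_fun setT Phi.

Let mA : measurable_fun setT A.
Proof. by apply: measurable_funB => //; apply: measurable_funB => //; exact: measurable_inner. Qed.

(** Expanding the kernel gives one Fourier coefficient per frequency; the weight of
    each is at most the central one, which equals the mean of the kernel. *)
Lemma integral_cos_kernel_le :
  \int[lebesgue_cV R d]_(z in cube d) (cos (A z) * cube_kernel N w z) <=
  @kernel_mass R d N *
    \sum_(f : {ffun 'I_d -> 'I_(kernel_degree N).+1} | [forall i, (f i <= (N i).*2)%N])
      coef (n - kernel_freq f).
Proof.
pose s (f : {ffun 'I_d -> 'I_(kernel_degree N).+1}) (z : 'cV[R]_d) : R :=
  \sum_(i < d) (kernel_freq f i 0)%:~R * (z i 0 - w i 0).
have ms f : measurable_fun setT (s f).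
  apply: measurable_sum => i _; apply: measurable_funM => //.
  by apply: measurable_funB => //; exact: measurable_coord.
have mAs f : measurable_fun setT (fun z => cos (A z + s f z)).
  apply: measurableT_comp; first exact: measurable_cos.
  exact: measurable_funD.
have iAs f : (lebesgue_cV R d).-integrable (cube d)
    (EFin \o (fun z => cos (A z + s f z))).
  by apply: (@cube_integrable _ _ _ 1) => // z; exact: cos_max.
have mc : measurable (@cube R d) by exact: measurable_cube.
under eq_Rintegral do rewrite cos_mul_kernel.
rewrite Rintegral_sum//; last first.
  by move=> f; exact: (integrableZl mc (@kernel_coef R d N f) (iAs f)).
apply: (@le_trans _ _ (\sum_f @kernel_coef R d N f * ((2 * pi) ^+ d * coef (n - kernel_freq f)))).
  apply: ler_sum => f _; rewrite RintegralZl//; last exact: iAs.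
  apply: ler_wpM2l; first by apply: prodr_ge0 => i _; exact: cos_coef_ge0.
  (* the shift by [w] in the kernel is absorbed by the reference phase *)
  pose theta' := theta + \sum_(i < d) (kernel_freq f i 0)%:~R * w i 0.
  have := norm_fourier_coef_ge (n - kernel_freq f) theta' mPhi.
  apply: le_trans; rewrite le_eqVlt; apply/orP; left; apply/eqP.
  apply: eq_Rintegral => z _; congr (cos _).
  have -> : inner (map_mx intr (n - kernel_freq f)) z =
      inner (map_mx intr n) z - \sum_(i < d) (kernel_freq f i 0)%:~R * z i 0.
    rewrite /inner -sumrB; apply: eq_bigr => i _.
    have e : (n - kernel_freq f) i 0 = n i 0 - kernel_freq f i 0 by rewrite !mxE.
    by rewrite -mulrBl; congr (_ * _); rewrite mxE e rmorphB/= [in RHS]mxE.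
  have -> : \sum_(i < d) (kernel_freq f i 0)%:~R * (z i 0 - w i 0) = \sum_(i < d) (kernel_freq f i 0)%:~R * z i 0 -
      \sum_(i < d) (kernel_freq f i 0)%:~R * w i 0.
    by rewrite -sumrB; apply: eq_bigr => i _; rewrite mulrBr.
  by rewrite /A /theta'; ring.
rewrite mulr_sumr [leRHS]big_mkcond; apply: ler_sum => f _.
case: ifPn => [_|]; last first.
  move=> /forallPn[j].
  by rewrite -ltnNge => fj; rewrite /kernel_coef (bigD1 j)//= /cos_coef bin_small// !mul0r.
rewrite mulrA ler_wpM2r ?normc_ge0//.
rewrite /kernel_mass big_split/= prodr_const card_ord mulrC ler_wpM2l//.
  by rewrite exprn_ge0// mulr_ge0// pi_ge0.
by apply: ler_prod => i _; rewrite cos_coef_ge0 cos_coef_max.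
Qed.

Hypothesis far_small : forall i,
  (\int[lebesgue_measure]_(t in `[(- pi)%R, pi%R])
      (((rho i <= `|t - w i 0|)%R%:R * cos ((t - w i 0) / 2) ^+ (N i).*2)%:E) <=
   (cos 1 / (4 * d.+1%:R) * (2 * pi * cos_coef (N i) (N i)))%:E)%E.

Hypothesis near_cos : forall z, cube d z ->
  (forall i, `|z i 0 - w i 0| < rho i) -> cos 1 <= cos (A z).

(** Pointwise, [cos A] is at least [cos 1] minus twice the number of coordinates
    that are far from [w]; the hypothesis [far_small] makes the second term at most
    half of the first one after integration. *)
Lemma integral_cos_kernel_ge : cos 1 / 2 * @kernel_mass R d N <=
  \int[lebesgue_cV R d]_(z in cube d) (cos (A z) * cube_kernel N w z).
Proof.
have c1 := @cos1_gt0 R.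
have mc : measurable (@cube R d) by exact: measurable_cube.
have mK := measurable_cube_kernel N w.
have mfar i : measurable_fun setT (far w (rho i) i).
  exact: measurableT_comp (measurable_far (w i 0) (rho i)) (measurable_coord i 0).
have ifar i : (lebesgue_cV R d).-integrable (cube d)
    (EFin \o (fun z => far w (rho i) i z * cube_kernel N w z)).
  apply: (@cube_integrable _ _ _ 1); first exact: measurable_funM.
  move=> z; rewrite normrM mulr_ile1 ?cube_kernel_le1// /far.
  by rewrite ger0_norm// lern1 leq_b1.
have iK : (lebesgue_cV R d).-integrable (cube d) (EFin \o cube_kernel N w).
  by apply: (@cube_integrable _ _ _ 1) => // z; exact: cube_kernel_le1.
have isum : (lebesgue_cV R d).-integrable (cube d)
    (EFin \o (fun z => \sum_(i < d) far w (rho i) i z * cube_kernel N w z)).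
  have := integrable_sum mc (index_enum 'I_d) (fun i _ => ifar i) (P := xpredT).
  by under eq_fun do rewrite sumEFin.
apply: (@le_trans _ _ (\int[lebesgue_cV R d]_(z in cube d)
   (cos 1 * cube_kernel N w z - 2 * \sum_(i < d) far w (rho i) i z * cube_kernel N w z))).
  rewrite RintegralB//; [|exact: (integrableZl mc (cos 1) iK)|exact: (integrableZl mc 2 isum)].
  rewrite !RintegralZl// integral_kernel Rintegral_sum//.
  have : \sum_(i < d) \int[lebesgue_cV R d]_(z in cube d) (far w (rho i) i z * cube_kernel N w z)
      <= \sum_(i < d) (cos 1 / (4 * d.+1%:R) * @kernel_mass R d N).
    apply: ler_sum => i _; apply: integral_kernel_far => //.
    by rewrite divr_ge0// ltW.
  rewrite sumr_const card_ord -[leRHS]mulr_natl => hS.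
  have : d%:R * (cos 1 / (4 * d.+1%:R) * @kernel_mass R d N) <= cos 1 / 4 * @kernel_mass R d N.
    rewrite mulrA; apply: ler_wpM2r; first exact/ltW/kernel_mass_gt0.
    have -> : d%:R * (cos 1 / (4 * d.+1%:R)) = cos 1 / 4 * (d%:R / d.+1%:R) :> R.
      by rewrite invfM; ring.
    by rewrite ler_piMr ?divr_ge0 ?(ltW c1)// ler_pdivrMr// mul1r ler_nat.
  move=> /(le_trans hS); set S := \sum_(i < d) _.
  move: S (kernel_mass N) => S M SM.
  rewrite (_ : cos 1 / 2 * M = cos 1 * M - 2 * (cos 1 / 4 * M)); last by field.
  by rewrite lerD2l lerN2 ler_pM2l.
apply: le_Rintegral => //.
- exact: (integrableB mc (integrableZl mc (cos 1) iK) (integrableZl mc 2 isum)).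
- apply: (@cube_integrable _ _ _ 1).
    by apply: measurable_funM => //; apply: measurableT_comp => //; exact: measurable_cos.
  by move=> z; rewrite normrM mulr_ile1 ?cube_kernel_le1 ?cos_max.
move=> z cz; rewrite -mulr_suml mulrA -mulrBl ler_wpM2r ?cube_kernel_ge0//.
have [near|] := pselect (forall i, `|z i 0 - w i 0| < rho i).
  apply: le_trans (near_cos cz near).
  by rewrite gerBl mulr_ge0// sumr_ge0.
move=> /existsNP[i /negP]; rewrite -leNgt => fi.
rewrite (bigD1 i)//= {1}/far fi -[true%:R]/(1%R : R).
have : 0 <= \sum_(j < d | j != i) far w (rho j) j z by rewrite sumr_ge0.
move: (\sum_(j < d | _) _) (cos_geN1 (A z)) (cos_le1 (1 : R)) => S.
by move: (cos _) (cos _) => x y; lra.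
Qed.

Lemma local_fourier_mass : ((cos 1 / 2)%:E <=
  \esum_(L in [set L : 'cV[int]_d | forall i, (`|n i 0 - L i 0| <= (N i)%:Z)%R]) (coef L)%:E)%E.
Proof.
have := le_trans integral_cos_kernel_ge integral_cos_kernel_le.
rewrite mulrC ler_pM2l ?kernel_mass_gt0// => h.
apply: (@le_trans _ _ (\sum_(f : {ffun 'I_d -> 'I_(kernel_degree N).+1} |
   [forall i, (f i <= (N i).*2)%N]) (coef (n - kernel_freq f))%:E)%E).
  by rewrite sumEFin lee_fin.
apply: (sum_le_esum (fun L => (coef L)%:E)) => [f g _ _|f /forallP fN i].
  move/addrI/oppr_inj/colP => fg; apply/ffunP => i; apply: val_inj => /=.
  by have := fg i; rewrite !mxE => /addrI/oppr_inj [].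
rewrite /= !mxE opprB addrC subrK ler_norml.
by have := fN i; rewrite -muln2; move: (f i : nat) (N i) => j k; lia.
Qed.
End local_fourier_mass.

(** * Periodicity and the phase *)

Lemma periodic_shift (R : realType) (d : nat) (T : Type) (f : 'cV[R]_d -> T)
    (s : seq 'I_d) (c : 'I_d -> int) (x : 'cV[R]_d) : Defs.periodic f ->
  f (x + \sum_(i <- s) (2 * pi * (c i)%:~R) *: delta_mx i 0) = f x.
Proof.
move=> pf.
have shift1 i (l : int) y : f (y + (2 * pi * l%:~R) *: delta_mx i 0) = f y.
  have shiftn j : forall y, f (y + (2 * pi * j%:R) *: delta_mx i 0) = f y.
    elim: j => [|j IH] {}y; first by rewrite mulr0 scale0r addr0.
    by rewrite -[j.+1%:R]natr1 mulrDr mulr1 scalerDl addrA pf IH.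
  case: l => j; first by rewrite -pmulrn shiftn.
  rewrite NegzE mulrNz mulrN scaleNr -[LHS](shiftn j.+1).
  by rewrite -pmulrn subrK.
elim: s x => [|i s IH] x; first by rewrite big_nil addr0.
by rewrite big_cons addrA IH shift1.
Qed.

Lemma periodic_cube (R : realType) (d : nat) (T : Type) (f : 'cV[R]_d -> T)
    (x : 'cV[R]_d) : Defs.periodic f -> exists2 y, cube d y & f y = f x.
Proof.
move=> pf; have pi0 := @pi_gt0 R.
pose c i := - Num.floor ((x i 0 + pi) / (2 * pi)).
exists (x + \sum_(i <- index_enum 'I_d) (2 * pi * (c i)%:~R) *: delta_mx i 0); last exact: periodic_shift.
move=> i; rewrite mxE summxE (bigD1 i)//= big1 => [|j ji]; last first.
  by rewrite !mxE eq_sym (negPf ji) mulr0.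
rewrite !mxE !eqxx /= mulr1 addr0 /c rmorphN/=.
have := floor_itv ((x i 0 + pi) / (2 * pi)).
set l := (Num.floor _)%:~R; rewrite intrD -/l => /andP[].
rewrite ler_pdivlMr ?ltr_pdivrMr ?mulr_gt0// => l1 l2.
by apply/andP; split; nra.
Qed.

(** A point on the boundary of the cube is moved inside along the ray to the
    origin.  Interior points are needed since the kernel centred at a boundary
    point would share its mass with the opposite faces. *)
Lemma cube_interior_near (R : realType) (d : nat) (x : 'cV[R]_d) (U : set 'cV[R]_d) :
  cube d x -> nbhs x U -> exists2 y, U y & forall i, `|y i 0| < pi.
Proof.
move=> cx /(@nbhs_ballP R 'cV[R]_d)[e /= e0 eU].
have pi0 := @pi_gt0 R.
pose t := Num.min (1 / 2) (e / (2 * pi)).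
have t0 : 0 < t by rewrite lt_min !divr_gt0// mulr_gt0.
have t1 : t <= 1 / 2 by rewrite ge_min lexx.
have te : t * pi < e.
  have : t <= e / (2 * pi) by rewrite ge_min lexx orbT.
  by rewrite ler_pdivlMr ?mulr_gt0//; nra.
have xpi i : `|x i 0| <= pi by rewrite ler_norml; exact: cx.
exists ((1 - t) *: x).
  apply: eU; split => // i j; rewrite ord1 !mxE /ball/=.
  rewrite (_ : x i 0 - (1 - t) * x i 0 = t * x i 0); last by ring.
  by rewrite normrM gtr0_norm//; apply: le_lt_trans te; rewrite ler_pM2l.
move=> i; rewrite mxE normrM ger0_norm; last lra.
apply: (@le_lt_trans _ _ ((1 - t) * pi)); first by rewrite ler_wpM2l//; lra.
by nra.
Qed.

Lemma class_A_periodic (R : realType) (p q : nat) (s : 'cV[R]_p -> 'cV[R]_q) :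
  class_A s -> Defs.periodic s.
Proof.
move=> sA i x; apply/colP => j.
by have [/(_ i x) + _ _] := sA j => -[].
Qed.

Lemma continuous_inner (R : realType) (T : topologicalType) (q : nat)
    (s : T -> 'cV[R]_q) (c : 'cV[R]_q) :
  (forall j, continuous (fun x => s x j 0)) -> continuous (fun x => inner (s x) c).
Proof.
move=> cs; rewrite /inner; apply: continuous_big => [|j _ x].
  exact: add_continuous.
by apply: cvgM; [exact: cs|exact: cvg_cst].
Qed.

Lemma continuous_affine_inner (R : realType) (T : topologicalType) (q : nat)
    (s : T -> 'cV[R]_q) (u : 'cV[R]_q) (c t : R) :
  (forall j, continuous (fun x => s x j 0)) ->
  continuous (fun x => c * inner (s x) u - t).
Proof.
move=> cs x; apply: cvgB; last exact: cvg_cst.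
by apply: cvgM; [exact: cvg_cst|exact: (continuous_inner cs)].
Qed.

Lemma inner_mulmx (R : realType) (m : nat) (v u : 'cV[R]_m) (P : 'M[R]_m) :
  inner v (P *m u) = \sum_(i < m) inner v (col i P) * u i 0.
Proof.
rewrite /inner; under eq_bigr do rewrite mxE mulr_sumr.
rewrite exchange_big; apply: eq_bigr => i _; rewrite mulr_suml.
by apply: eq_bigr => j _; rewrite mxE mulrA.
Qed.

Lemma innerDr (R : realType) (m : nat) (v u w : 'cV[R]_m) :
  inner v (u + w) = inner v u + inner v w.
Proof. by rewrite /inner -big_split; apply: eq_bigr => i _; rewrite mxE mulrDr. Qed.

Lemma measurable_phase (R : realType) (k m : nat) (a : 'cV[R]_k -> 'cV[R]_m)
    (b : 'cV[R]_m -> 'cV[R]_m) :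
  (forall j, continuous (fun x => a x j 0)) ->
  (forall j, continuous (fun y => b y j 0)) ->
  measurable_fun setT (phase a b).
Proof.
move=> ca cb; apply: measurable_sum => i _.
have mu : measurable_fun setT (fun z : 'cV[R]_(k + m) => usubmx z).
  apply: measurable_fun_matrix => j l; under eq_fun do rewrite mxE.
  exact: measurable_coord.
have md : measurable_fun setT (fun z : 'cV[R]_(k + m) => dsubmx z).
  apply: measurable_fun_matrix => j l; under eq_fun do rewrite mxE.
  exact: measurable_coord.
apply: measurable_funM => //.
- exact: (measurableT_comp (continuous_measurable_mx (ca i)) mu).
- exact: (measurableT_comp (continuous_measurable_mx (cb i)) md).
Qed.

Lemma inner_col_mx0 (R : realType) (k m : nat) (n : 'cV[int]_m) (z : 'cV[R]_(k + m)) :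
  inner (map_mx intr (col_mx 0 n)) z = inner (map_mx intr n) (dsubmx z).
Proof.
rewrite /inner big_split_ord/= big1 ?add0r; last first.
  by move=> i _; rewrite mxE col_mxEu mxE mul0r.
by apply: eq_bigr => i _; rewrite mxE col_mxEd [dsubmx z i 0]mxE [in RHS]mxE.
Qed.


(** * Fourier mass at the frequencies reached by the gradient *)

Section frequency.
Context {R : realType} (k m : nat) (a : 'cV[R]_k -> 'cV[R]_m) (b : 'cV[R]_m -> 'cV[R]_m).
Hypotheses (ha : class_A a) (hb : class_A b).
Variables (J : set 'cV[R]_m) (P : 'M[R]_m) (y0 yc : 'cV[R]_m).
Hypothesis hbJ : forall y, J y -> b y = P *m y + y0.

(** The [y]-gradient of [lambda phase - (n, y)] over [J]. *)
Let detuning (lambda : R) (n : 'cV[int]_m) (i : 'I_m) x :=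
  lambda * inner (a x) (col i P) - (n i 0)%:~R.

(** The phase relative to its value at [(x1, yc)] splits into a term linear in
    [y - yc], whose slope is the detuning, and a term depending on [x] only. *)
Lemma phase_local (lambda : R) (n : 'cV[int]_m) (z : 'cV[R]_(k + m)) (x1 : 'cV[R]_k) :
  J (dsubmx z) ->
  lambda * phase a b z - inner (map_mx intr (col_mx 0 n)) z -
    (lambda * inner (a x1) (P *m yc + y0) - inner (map_mx intr n) yc) =
  \sum_(i < m) detuning lambda n i (usubmx z) * (dsubmx z i 0 - yc i 0) +
  (lambda * inner (a (usubmx z)) (P *m yc + y0) - lambda * inner (a x1) (P *m yc + y0)).
Proof.
move=> Jz; rewrite inner_col_mx0 /phase (hbJ Jz) !innerDr !inner_mulmx.
set y := dsubmx z; set x := usubmx z.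
have -> : \sum_(i < m) detuning lambda n i x * (y i 0 - yc i 0) =
  lambda * (\sum_(i < m) inner (a x) (col i P) * y i 0) -
  lambda * (\sum_(i < m) inner (a x) (col i P) * yc i 0) -
  (inner (map_mx intr n) y - inner (map_mx intr n) yc).
  rewrite /inner !mulr_sumr -!sumrB; apply: eq_bigr => i _.
  by rewrite /detuning /inner [map_mx _ _ i 0]mxE; ring.
by ring.
Qed.

Lemma near_dist (n : nat) (g : 'cV[R]_n -> R) (x : 'cV[R]_n) (r : R) :
  continuous g -> 0 < r -> nbhs x [set y | `|g y - g x| < r].
Proof.
move=> cg r0; have /(@nbhs_ballP R 'cV[R]_n)[e e0 he] := cg x _ (nbhsx_ballx (g x) r r0).
by apply/nbhs_ballP; exists e => // y /he; rewrite /ball/= distrC.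
Qed.

(** [N] is chosen before [lambda] and [n]: it depends only on [yc] and on the radius
    [ry] of a neighbourhood of [yc] in [J] that is small enough for slopes at most
    2 to change the phase by at most 1 / 2.  The radii [rx] and exponents [Nx] in
    the [x]-variables are chosen afterwards. *)
Lemma frequency_mass : open J -> J `<=` cube m -> J yc -> exists N : nat,
  forall (lambda : R) (n : 'cV[int]_m),
    (exists x, forall i, `|detuning lambda n i x| <= 1) ->
  ((cos 1 / 2)%:E <=
    \esum_(L in [set L : 'cV[int]_(k + m) |
        forall i, (`|n i 0 - L (rshift k i) 0| <= N%:Z)%R])
      (Normc.normc (fourier_coef (fun z => expi (lambda * phase a b z)) L))%:E)%E.
Proof.
move=> oJ Jcube Jyc; have c1 := @cos1_gt0 R; have pi0 := @pi_gt0 R.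
have /(@nbhs_ballP R 'cV[R]_m)[e /= e0 eJ] : nbhs yc J by exact: open_nbhs_nbhs.
(* the total variation of the phase in [y] is at most [2 m ry <= 1 / 2] *)
pose ry := Num.min (e / 2) (1 / (4 * m.+1%:R)).
have ry0 : 0 < ry by rewrite lt_min !divr_gt0// mulr_gt0.
have rye : ry < e by rewrite gt_min; apply/orP; left; lra.
have rym : ry <= 1 / (4 * m.+1%:R) by rewrite ge_min lexx orbT.
pose ep := cos 1 / (4 * (k + m).+1%:R) : R.
have ep0 : 0 < ep by rewrite divr_gt0// mulr_gt0.
have ycpi (i : 'I_m) : - pi <= yc i 0 - ry /\ yc i 0 + ry <= pi.
  have yJ (t : R) : `|t| <= ry -> J (yc + t *: delta_mx i 0).
    move=> tr; apply: eJ; split=> // j l; rewrite !mxE /ball/= opprD addNKr normrN.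
    apply: le_lt_trans rye; apply: le_trans tr.
    by rewrite normrM; case: (_ && _); rewrite ?normr1 ?normr0 ?mulr1 ?mulr0.
  have := Jcube _ (yJ ry _) i; have := Jcube _ (yJ (- ry) _) i.
  rewrite normrN gtr0_norm// !mxE !eqxx/= !mulr1 => /(_ (lexx _))/andP[? _] /(_ (lexx _))/andP[_ ?].
  by split.
have [Ny hNy] := choice (fun i => cos_pow_concentrates (ycpi i).1 (ycpi i).2 ry0 ep0).
exists (\max_(i < m) Ny i)%N => lambda n [x0 hx0].
have ca := class_A_continuous ha; have cb := class_A_continuous hb.
have cv i : continuous (detuning lambda n i).
  exact: (continuous_affine_inner ca).
have [x2 cx2 ax2] := periodic_cube x0 (class_A_periodic ha).
(* slopes at most 1 at [x2] become at most 3 / 2 at an interior point [x1], and at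
   most 2 on a ball around [x1] *)
have [x1 vx1 x1pi] : exists2 x1, (forall i, `|detuning lambda n i x1| < 3 / 2) &
    forall i, `|x1 i 0| < pi.
  apply: (cube_interior_near cx2 (U := [set x1 | forall i, `|detuning lambda n i x1| < 3 / 2])).
  apply: (filter_forall (@nbhs_filter 'cV[R]_k x2)) => i.
  apply: (@filterS _ _ (@nbhs_filter 'cV[R]_k x2) _ _ _
    (near_dist x2 (cv i) (r := 1 / 2) _)); last lra.
  have e2 : detuning lambda n i x2 = detuning lambda n i x0 by rewrite /detuning ax2.
  move=> y /= hy; have := hx0 i; rewrite -e2.
  by have := ler_normD (detuning lambda n i y - detuning lambda n i x2) (detuning lambda n i x2); rewrite subrK; lra.
pose psi x := lambda * inner (a x) (P *m yc + y0) - inner (map_mx intr n) yc.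
have cpsi : continuous psi.
  exact: (continuous_affine_inner ca).
have [e1 /= e10 he1] : exists2 e1 : R, 0 < e1 & ball x1 e1 `<=`
    [set x | (forall i, `|detuning lambda n i x| < 2) /\ `|psi x - psi x1| < 1 / 2].
  apply/(@nbhs_ballP R 'cV[R]_k).
  apply: (@filterI _ _ (@nbhs_filter 'cV[R]_k x1)); last by apply: near_dist => //; lra.
  apply: (filter_forall (@nbhs_filter 'cV[R]_k x1)) => i.
  apply: (@filterS _ _ (@nbhs_filter 'cV[R]_k x1) _ _ _
    (near_dist x1 (cv i) (r := 1 / 2) _)); last lra.
  move=> y /= hy; have := vx1 i.
  by have := ler_normD (detuning lambda n i y - detuning lambda n i x1) (detuning lambda n i x1); rewrite subrK; lra.
pose rx (i : 'I_k) := Num.min e1 (pi - `|x1 i 0|).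
have rx0 i : 0 < rx i by rewrite lt_min e10 subr_gt0 x1pi.
have rxpi i : - pi <= x1 i 0 - rx i /\ x1 i 0 + rx i <= pi.
  have : rx i <= pi - `|x1 i 0| by rewrite ge_min lexx orbT.
  have := ler_norm (x1 i 0); have := ler_norm (- x1 i 0); rewrite normrN.
  by move=> *; split; lra.
have [Nx hNx] := choice (fun i => cos_pow_concentrates (rxpi i).1 (rxpi i).2 (rx0 i) ep0).
pose N (i : 'I_(k + m)) := match fintype.split i with inl j => Nx j | inr j => Ny j end.
pose rho (i : 'I_(k + m)) := match fintype.split i with inl j => rx j | inr j => ry end.
have mPhi : measurable_fun setT (fun z => lambda * phase a b z).
  by apply: measurable_funM => //; exact: measurable_phase.
have rowL (z : 'cV[R]_(k + m)) (j : 'I_k) : z (lshift m j) 0 = usubmx z j 0 by rewrite mxE.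
have rowR (z : 'cV[R]_(k + m)) (j : 'I_m) : z (rshift k j) 0 = dsubmx z j 0 by rewrite mxE.
have NL j : N (lshift m j) = Nx j by rewrite /N (unsplitK (inl j)).
have NR j : N (rshift k j) = Ny j by rewrite /N (unsplitK (inr j)).
have rhoL j : rho (lshift m j) = rx j by rewrite /rho (unsplitK (inl j)).
have rhoR j : rho (rshift k j) = ry by rewrite /rho (unsplitK (inr j)).
have split_ind (Q : 'I_(k + m) -> Prop) : (forall j, Q (lshift m j)) ->
    (forall j, Q (rshift k j)) -> forall i, Q i.
  by move=> QL QR i; rewrite -(splitK i); case: (fintype.split i).
apply: le_trans (@local_fourier_mass R (k + m) N (col_mx x1 yc) rho _ (col_mx 0 n) (psi x1) mPhi _ _) _.
- apply: split_ind => j.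
    by rewrite NL rhoL col_mxEu; exact: hNx.
  by rewrite NR rhoR col_mxEd; exact: hNy.
- move=> z cz hz.
  have hx j : `|usubmx z j 0 - x1 j 0| < rx j.
    by have := hz (lshift m j); rewrite rhoL rowL col_mxEu.
  have hy j : `|dsubmx z j 0 - yc j 0| < ry.
    by have := hz (rshift k j); rewrite rhoR rowR col_mxEd.
  have Jz : J (dsubmx z).
    apply: eJ; split => // i j; rewrite ord1 /ball/= distrC.
    exact: lt_trans (hy i) rye.
  have [vz psiz] : (forall i, `|detuning lambda n i (usubmx z)| < 2) /\
      `|psi (usubmx z) - psi x1| < 1 / 2.
    apply: he1; split => // i j; rewrite ord1 /ball/= distrC.
    by apply: lt_le_trans (hx i) _; rewrite ge_min lexx.
  rewrite -[leRHS]cos_norm; apply: cos_le => //; last by have := @pi_ge2 R; lra.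
  rewrite phase_local//.
  rewrite (_ : _ - lambda * inner (a x1) _ = psi (usubmx z) - psi x1); last by rewrite /psi; ring.
  apply: le_trans (ler_normD _ _) _.
  have : `|\sum_(i < m) detuning lambda n i (usubmx z) * (dsubmx z i 0 - yc i 0)| <= 1 / 2.
    apply: le_trans (ler_norm_sum _ _ _) _.
    apply: (@le_trans _ _ (\sum_(i < m) 2 * ry)).
      by apply: ler_sum => i _; rewrite normrM ler_pM// ltW.
    rewrite sumr_const card_ord -[leLHS]mulr_natl.
    by move: rym; rewrite ler_pdivlMr ?mulr_gt0// -[m.+1%:R]natr1; lra.
  by move: psiz; lra.
rewrite esum_mkcond [leRHS]esum_mkcond; apply: le_esum => L _.
case: ifPn => [|_]; last by case: ifP => // _; rewrite lee_fin normc_ge0.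
rewrite inE => hL; rewrite mem_set// => i.
have := hL (rshift k i); rewrite NR col_mxEd => /le_trans; apply.
by rewrite lez_nat (leq_bigmax (F := Ny)).
Qed.
End frequency.

(** * Covering and counting *)

(** The set where [|lambda P^T v - n| <= 1] coordinatewise is the image of a unit
    cube under [lambda^-1 P^-T], hence lies in a box around [lambda^-1 P^-T n]
    whose side is [2 / |lambda|] times a norm of [P^-T]. *)
Lemma measure_cover (R : realType) (m : nat) (P : 'M[R]_m) (A : set 'cV[R]_m) :
  \det P != 0 -> measurable A -> exists2 C : R, 0 < C &
  forall (lambda : R) (I : finType) (n : I -> 'cV[int]_m) (G : pred I),
    lambda != 0 ->
    (forall v, A v -> exists i, G i /\
       forall j, `|lambda * inner v (col j P) - (n i j 0)%:~R| <= 1) ->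
    (lebesgue_cV R m A <= (#|G|%:R * (C / `|lambda|) ^+ m)%:E)%E.
Proof.
move=> dP mA; pose Q := invmx P^T.
(* a bound for the sums of the rows of [|Q|], made positive by the 1 *)
pose q : R := 1 + \sum_i \sum_j `|Q i j|.
have q0 : 0 < q.
  by rewrite ltr_pwDl// sumr_ge0// => i _; rewrite sumr_ge0.
exists (2 * q); first by rewrite mulr_gt0.
move=> lambda I n G l0 AG.
have l0' : 0 < `|lambda| by rewrite normr_gt0.
pose c i := lambda^-1 *: (Q *m map_mx intr (n i)).
pose r := q / `|lambda|.
have r0 : 0 < r by rewrite divr_gt0.
pose box i : set 'cV[R]_m := [set v | forall j, (`[c i j 0 - r, c i j 0 + r]%classic : set R) (v j 0)].
have mubox i : lebesgue_cV R m (box i) = ((2 * q / `|lambda|) ^+ m)%:E.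
  rewrite (@lebesgue_cV_prod R m (fun j => `[c i j 0 - r, c i j 0 + r]%classic)); last first.
    by move=> j; exact: measurable_itv.
  under eq_bigr.
    move=> j _; rewrite lebesgue_measure_itv/= lte_fin ifT; last lra.
    rewrite -EFinD.
    over.
  rewrite prodEFin; congr (_%:E).
  transitivity (\prod_(j < m) (2 * q / `|lambda|)).
    by apply: eq_bigr => j _; rewrite /r; ring.
  by rewrite prodr_const card_ord.
have mbox i : measurable (box i).
  rewrite [X in measurable X](_ : _ = \bigcap_(j in [set: 'I_m])
      ((fun x : 'cV[R]_m => x j 0) @^-1` `[c i j 0 - r, c i j 0 + r]%classic)); last first.
    by apply/seteqP; split => x /= h j; [move=> _; exact: h|exact: (h j Logic.I)].
  apply: fin_bigcap_measurable => // j _.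
  rewrite -[X in measurable X]setTI; apply: measurable_coord => //; exact: measurable_itv.
have := @content_sub_fsum _ _ _ (lebesgue_cV R m) _ [set` enum G] A box.
move=> /(_ (finite_seq _) (fun i _ => mbox i) mA) /(_ _)/le_trans; apply.
  move=> v /AG [i [Gi hi]]; exists i; first by rewrite /= mem_enum.
  move=> j; rewrite /= in_itv/=.
  have uP : P^T \in unitmx by rewrite unitmx_tr unitmxE unitfE.
  have ev : v = Q *m (P^T *m v) by rewrite mulKmx.
  have : `|v j 0 - c i j 0| <= r.
    have -> : v j 0 - c i j 0 = lambda^-1 *
        \sum_l Q j l * (lambda * inner v (col l P) - (n i l 0)%:~R).
      rewrite {1}ev /c mxE [X in _ - X]mxE [X in _ - _ * X]mxE.
      rewrite !mulr_sumr -sumrB; apply: eq_bigr => l _.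
      have -> : (P^T *m v) l 0 = inner v (col l P).
        by rewrite mxE /inner; apply: eq_bigr => s _; rewrite !mxE mulrC.
      by rewrite [map_mx _ _ l 0]mxE; field.
    rewrite normrM normfV mulrC ler_wpM2r ?invr_ge0//.
    apply: le_trans (ler_norm_sum _ _ _) _.
    apply: (@le_trans _ _ (\sum_l `|Q j l|)).
      by apply: ler_sum => l _; rewrite normrM ler_piMr.
    rewrite /q [X in 1 + X](bigD1 j)//= addrCA lerDl addr_ge0// sumr_ge0// => s _.
    by rewrite sumr_ge0.
  rewrite ler_norml => /andP[h1 h2]; apply/andP; split; lra.
rewrite -fsbig_seq ?enum_uniq//.
rewrite (eq_bigr (fun=> ((2 * q / `|lambda|) ^+ m)%:E)); last by move=> i _; exact: mubox.
rewrite sumEFin big_enum sumr_const lee_fin -[leLHS]mulr_natl.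
by rewrite le_eqVlt eqxx.
Qed.

(** Integer vectors with coordinates in [[- K, K]], indexed by a finite type. *)
Definition shifted_freq (m K : nat) (f : {ffun 'I_m -> 'I_K.*2.+1}) : 'cV[int]_m :=
  \col_i ((f i)%:Z - K%:Z).

(** [f] is determined by the vector of the [f_i - K - L_i + N], whose coordinates
    lie in [[0, 2 N]]. *)
Lemma count_near (m K N : nat) (L : 'I_m -> int) :
  (#|[pred f : {ffun 'I_m -> 'I_K.*2.+1} |
     [forall i, (`|shifted_freq f i 0 - L i| <= N%:Z)%R]]| <= N.*2.+1 ^ m)%N.
Proof.
set S := [pred f | _].
pose h (f : {ffun 'I_m -> 'I_K.*2.+1}) : {ffun 'I_m -> 'I_N.*2.+1} :=
  [ffun i => inord `|(shifted_freq f i 0 - L i + N%:Z)%R|%N].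
have hinj : {in S &, injective h}.
  move=> f g /forallP fS /forallP gS /ffunP fg; apply/ffunP => i; apply/val_inj => /=.
  have := congr1 val (fg i); rewrite !ffunE /=.
  have := fS i; have := gS i; rewrite !mxE !ler_norml.
  move: (f i : nat) (g i : nat) => x y hy hx.
  have bx z : (- N%:Z <= z%:Z - K%:Z - L i <= N%:Z)%R ->
     (`|(z%:Z - K%:Z - L i + N%:Z)%R|%N < N.*2.+1)%N by rewrite -muln2; lia.
  rewrite !inordK; [|exact: bx|exact: bx]; lia.
rewrite -(card_in_imset hinj); apply: leq_trans (max_card _) _.
by rewrite card_ffun !card_ord.
Qed.

Lemma continuous_cube_bounded (R : realType) (k : nat) (g : 'cV[R]_k -> R) :
  continuous g -> exists M : R, forall x, cube k x -> `|g x| <= M.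
Proof.
move=> cg; have cK : compact (g @` cube k).
  by apply: continuous_compact; [exact: continuous_subspaceT|exact: cube_compact].
have [M [_ HM]] := compact_bounded cK.
exists (M + 1) => x cx; apply: (HM (M + 1)); first by rewrite ltrDl.
by exists x.
Qed.

Lemma class_A_range (R : realType) (p q : nat) (s : 'cV[R]_p -> 'cV[R]_q) :
  class_A s -> range s = s @` cube p.
Proof.
move=> sA; apply/seteqP; split => [_ [x _ <-]|_ [x _ <-]]; last by exists x.
by have [y cy <-] := periodic_cube x (class_A_periodic sA); exists y.
Qed.

Lemma measurable_range (R : realType) (p q : nat) (s : 'cV[R]_p -> 'cV[R]_q) :
  class_A s -> measurable (range s).
Proof.
move=> sA; rewrite (class_A_range sA); apply: compact_measurable_mx.
apply: continuous_compact; last exact: cube_compact.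
by apply: continuous_subspaceT; apply: continuous_mx; exact: class_A_continuous.
Qed.

(** [a] is bounded, hence so are the integer parts of [lambda P^T a(x)]. *)
Lemma frequencies_finite (R : realType) (k m : nat) (a : 'cV[R]_k -> 'cV[R]_m)
    (P : 'M[R]_m) (lambda : R) : class_A a ->
  exists K : nat, forall x, exists f : {ffun 'I_m -> 'I_K.*2.+1},
    forall i, `|lambda * inner (a x) (col i P) - (shifted_freq f i 0)%:~R| <= 1.
Proof.
move=> ha; have ca := class_A_continuous ha.
have [M HM] := choice (fun i => continuous_cube_bounded
  (continuous_affine_inner (u := col i P) (c := lambda) (t := 0) ca)).
pose B := \sum_i `|M i|.
have B0 : 0 <= B by rewrite sumr_ge0.
pose K := Num.bound (B + 1).
have BK : B + 1 < K%:R by rewrite archi_boundP// addr_ge0.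
exists K => x0.
have [x cx <-] := periodic_cube x0 (class_A_periodic ha).
pose g i := Num.floor (lambda * inner (a x) (col i P)).
have gK i : `|g i| <= K%:Z.
  have : `|lambda * inner (a x) (col i P)| <= B.
    have := HM i x cx; rewrite subr0 => /le_trans; apply.
    apply: le_trans (ler_norm _) _; rewrite /B (bigD1 i)//= lerDl.
    by rewrite sumr_ge0.
  have /andP[] := floor_itv (lambda * inner (a x) (col i P)).
  rewrite -/(g i) intrD => h1 h2; rewrite !ler_norml => /andP[h3 h4].
  rewrite -!(ler_int R) mulrNz; apply/andP; split; rewrite -[K%:~R]/(K%:R : R); lra.
pose f : {ffun 'I_m -> 'I_K.*2.+1} := [ffun i => inord `|(g i + K%:Z)%R|%N].
exists f => i.
have -> : shifted_freq f i 0 = g i.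
  rewrite /shifted_freq mxE ffunE inordK; have := gK i; rewrite ler_norml; [lia|].
  by rewrite -muln2; lia.
have /andP[] := floor_itv (lambda * inner (a x) (col i P)).
by rewrite -/(g i) intrD ler_norml => h1 h2; apply/andP; split; lra.
Qed.

(** Double counting of the pairs [(f, L)] where the [y]-frequency of [L] is within
    [N] of that of [f]. *)
Lemma sum_local_mass_le (R : realType) (k m K N : nat) (u : 'cV[int]_(k + m) -> R)
    (c : R) (G : pred {ffun 'I_m -> 'I_K.*2.+1}) :
  (forall L, 0 <= u L) ->
  (forall f, G f -> (c%:E <= \esum_(L in [set L : 'cV[int]_(k + m) |
     forall i, (`|shifted_freq f i 0 - L (rshift k i) 0| <= N%:Z)%R]) (u L)%:E)%E) ->
  ((#|G|%:R * c)%:E <=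
     \sum_(j < N.*2.+1 ^ m) \esum_(L in [set: 'cV[int]_(k + m)]) (u L)%:E)%E.
Proof.
move=> u0 hG.
pose near (f : {ffun 'I_m -> 'I_K.*2.+1}) := [set L : 'cV[int]_(k + m) |
     forall i, (`|shifted_freq f i 0 - L (rshift k i) 0| <= N%:Z)%R].
apply: (@le_trans _ _ (\sum_(f | G f) \esum_(L in near f) (u L)%:E)%E).
  rewrite mulr_natl -sumr_const -sumEFin; apply: lee_sum => f Gf; exact: hG.
under eq_bigr do rewrite esum_mkcond.
rewrite -!esum_sum; last 2 first.
- by move=> L j _ _; rewrite lee_fin.
- by move=> L f _ _; case: ifP => // _; rewrite lee_fin.
apply: le_esum => L _; rewrite sumEFin.
rewrite -big_mkcondr/= sumEFin lee_fin !sumr_const; apply: ler_wpMn2l => //.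
rewrite card_ord; apply: leq_trans (count_near K N (fun i => L (rshift k i) 0)).
apply: subset_leq_card; apply/fintype.subsetP => f /andP[_].
by rewrite !inE => h; apply/forallP => i; exact: h.
Qed.

(** * The lower bound for the norm *)

Theorem corollary2 (R : realType) (k m : nat) (hk : (1 <= k)%N) (hm : (1 <= m)%N)
    (a : 'cV[R]_k -> 'cV[R]_m) (b : 'cV[R]_m -> 'cV[R]_m)
    (ha : class_A a) (hb : class_A b)
    (J : set 'cV[R]_m) (hJ : domain J) (hJcube : J `<=` cube m)
    (P : 'M[R]_m) (y0 : 'cV[R]_m) (hP : \det P != 0)
    (hbJ : forall y : 'cV[R]_m, J y -> b y = P *m y + y0)
    (himg : (0 < lebesgue_cV R m (range a))%E) :
  exists c lambda0 : R, [/\ 0 < c, 0 < lambda0 &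
    forall lambda : R, lambda0 <= `|lambda| ->
      ((c * `|lambda| ^+ m)%:E <=
        A_norm (fun z : 'cV[R]_(k + m) => expi (lambda * phase a b z)))%E].
Proof.
have [[yc Jyc] _ oJ] := hJ.
have [N hN] := frequency_mass ha hb hbJ oJ hJcube Jyc.
have [C C0 hC] := measure_cover hP (measurable_range ha).
pose G lambda K : pred {ffun 'I_m -> 'I_K.*2.+1} := fun f => `[< exists x, forall i,
  `|lambda * inner (a x) (col i P) - (shifted_freq f i 0)%:~R| <= 1 >].
have cover lambda : lambda != 0 -> exists K,
    (lebesgue_cV R m (range a) <= (#|G lambda K|%:R * (C / `|lambda|) ^+ m)%:E)%E.
  move=> l0; have [K hK] := frequencies_finite P lambda ha; exists K.
  apply: (hC lambda _ (@shifted_freq m K)) => // _ [x _ <-].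
  have [f hf] := hK x; exists f; split => //; apply/asboolP; by exists x.
pose mu0 := fine (lebesgue_cV R m (range a)).
have mufin : lebesgue_cV R m (range a) = mu0%:E.
  have [K hK] := cover 1 (oner_neq0 _).
  by rewrite fineK// ge0_fin_numE//; apply: le_lt_trans hK _; rewrite ltry.
have mu00 : 0 < mu0 by rewrite -lte_fin -mufin.
have c1 := @cos1_gt0 R.
pose D := (N.*2.+1 ^ m)%N.
have D0 : 0 < D%:R :> R by rewrite ltr0n expn_gt0.
exists (cos 1 / 2 * mu0 / (C ^+ m * D%:R)), 1; split => //.
  by rewrite !divr_gt0// ?mulr_gt0// ?exprn_gt0// divr_gt0.
move=> lambda l1.
have l0' : 0 < `|lambda| by apply: lt_le_trans l1.
have l0 : lambda != 0 by rewrite -normr_gt0.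
have [K] := cover lambda l0; rewrite mufin lee_fin => hK.
pose u L := Normc.normc (fourier_coef (fun z => expi (lambda * phase a b z)) L).
have hG f : G lambda K f -> ((cos 1 / 2)%:E <= \esum_(L in [set L : 'cV[int]_(k + m) |
     forall i, (`|shifted_freq f i 0 - L (rshift k i) 0| <= N%:Z)%R]) (u L)%:E)%E.
  by move=> /asboolP; exact: hN.
have := sum_local_mass_le (fun L => normc_ge0 _) hG.
have -> : (\esum_(L in [set: 'cV[int]_(k + m)]) (u L)%:E)%E =
   A_norm (fun z => expi (lambda * phase a b z)) by [].
have : (0 <= A_norm (fun z => expi (lambda * phase a b z)))%E.
  by apply: esum_ge0 => L _; rewrite lee_fin normc_ge0.
case: (A_norm _) => [x| |]; [|by move=> *; rewrite leey|by []].
move=> _; rewrite sumEFin !lee_fin sumr_const card_ord -[leRHS]mulr_natl -/D => hx.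
rewrite mulrAC ler_pdivrMr ?mulr_gt0 ?exprn_gt0//.
have hL : mu0 * `|lambda| ^+ m <= #|G lambda K|%:R * C ^+ m.
  apply: le_trans (ler_wpM2r _ hK) _; first by rewrite exprn_ge0.
  by rewrite -mulrA -exprMn divfK// gt_eqF.
have h0 : 0 < cos 1 / 2 :> R by rewrite divr_gt0.
move: (cos 1 / 2) h0 hx => h h0 hx.
apply: (@le_trans _ _ (h * (#|G lambda K|%:R * C ^+ m))).
  by rewrite -mulrA ler_pM2l.
rewrite mulrA [C ^+ m * _]mulrC [leRHS]mulrA ler_pM2r ?exprn_gt0//.
by rewrite mulrC [leRHS]mulrC.
Qed.
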